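(* Let $\mathcal{C}=\mathbf{C}(z)$ be the differential field of complex rational functions. Let $a(z)$ be a meromorphic function on $\mathbf{C}$ that is differentially transcendental over $\mathcal{C}$, and let $f(z,u_0,u_1,\ldots,u_m,y_1,\ldots,y_n)$ be a polynomial over $\mathcal{C}$. For $1\le i\le m$ let $\alpha_i,\beta_i\in\mathbf{C}$ and let $E_i$ be the operator given by $(E_i h)(z)=h(\alpha_i z+\beta_i)$. If $b$ is a meromorphic function on $\mathbf{C}$ such that $$f(z,b,E_1b,\ldots,E_mb,Db,\ldots,D^nb)=a(z),$$ then $b$ is differentially transcendental over $\mathcal{C}$.
   Context: $D=d/dz$ is the usual differentiation. Let $\mathcal{M}$ be the differential field of meromorphic functions on the whole complex plane, with $\mathcal{C}=\mathbf{C}(z)\subseteq\mathcal{M}$. A function $h\in\mathcal{M}$ is differentially algebraic (d.a.) over $\mathcal{C}$ if there is a non-zero differential polynomial $p$ over $\mathcal{C}$ in one variable, i.e. a non-zero ordinary polynomial $p(x,y_1,\ldots,y_k)$ with coefficients in $\mathcal{C}$, such that $p(h,Dh,\ldots,D^kh)=0$; otherwise $h$ is differentially transcendental over $\mathcal{C}$. In the polynomial $f$, the argument $z$ is the identity function and belongs to $\mathcal{C}$, so $f$ is a polynomial in $u_0,\ldots,u_m,y_1,\ldots,y_n$ with coefficients in $\mathbf{C}(z)$. The functions $E_ib$ appearing in the equation are presupposed to be defined as meromorphic functions; this matters only when $\alpha_i=0$, in which case $E_ib$ is the constant $b(\beta_i)$ and $\beta_i$ must not be a pole of $b$. *)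

(* Defs.v *)
From mathcomp Require Import all_boot all_order all_algebra.
From mathcomp Require Import complex.
From mathcomp Require Import all_classical all_reals all_analysis.
From mathcomp Require Import -(notations) mpoly.

Set Implicit Arguments.
Unset Strict Implicit.
Unset Printing Implicit Defensive.

Import Order.TTheory GRing.Theory Num.Theory.
Import numFieldNormedType.Exports.

Local Open Scope classical_set_scope.
Local Open Scope ring_scope.

Definition Cplx (R : realType) : numFieldType := complex R.

(* A meromorphic function is encoded as a total function K -> K whose values
   at its poles are junk.  The definitions are stated over a numFieldType K so
   that K carries its norm topology and derivable/derive1 are taken with
   respect to K itself; they are used at K = Cplx R, where they give complex
   differentiability and the complex derivative. *)

Definition holomorphic_at (K : numFieldType) (f : K -> K) (z : K) : Prop :=
  \forall w \near z, derivable f w 1.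

(* a pole of order n.+1 *)
Definition pole (K : numFieldType) (f : K -> K) (z : K) : Prop :=
  exists (n : nat) (g : K -> K),
    [/\ holomorphic_at g z, g z != 0 &
        \forall w \near z^', f w = g w / (w - z) ^+ n.+1].

Definition meromorphic (K : numFieldType) (f : K -> K) : Prop :=
  forall z : K, holomorphic_at f z \/ pole f z.

(* Equality in the field of meromorphic functions: f and g agree outside a
   closed discrete set, so junk values at poles are irrelevant. *)
Definition mero_eq (K : numFieldType) (f g : K -> K) : Prop :=
  forall z : K, \forall w \near z^', f w = g w.

(* K(z) *)
Definition ratfun (K : numFieldType) := {fraction {poly K}}.

(* The chosen representative numerator/denominator need not be reduced, so the
   value is only meaningful off the finitely many roots of its denominator;
   this is harmless up to mero_eq. *)
Definition ratfun_eval (K : numFieldType) (r : ratfun K) (z : K) : K :=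
  (frac (repr r)).1.[z] / (frac (repr r)).2.[z].

(* The function z |-> p(z, h_0(z), ..., h_(n-1)(z)). *)
Definition mpoly_fun (K : numFieldType) (n : nat) (p : mpoly n (ratfun K))
    (h : 'I_n -> K -> K) : K -> K :=
  fun z => mmap (fun r : ratfun K => ratfun_eval r z) (fun i => h i z) p.

Definition diff_algebraic (K : numFieldType) (h : K -> K) : Prop :=
  exists (k : nat) (p : mpoly k.+1 (ratfun K)),
    p != 0 /\ mero_eq (mpoly_fun p (fun i => derive1n i h)) (fun=> 0).

Definition diff_transcendental (K : numFieldType) (h : K -> K) : Prop :=
  ~ diff_algebraic h.

Definition affine_op (K : numFieldType) (alpha beta : K) (h : K -> K) : K -> K :=
  fun z => h (alpha * z + beta).

(* The m.+1 + n arguments b, E_1 b, ..., E_m b, D b, ..., D^n b, in this order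
   (alpha and beta are indexed from 0). *)
Definition eq_args (K : numFieldType) (m n : nat) (alpha beta : 'I_m -> K)
    (b : K -> K) (j : 'I_(m.+1 + n)) : K -> K :=
  match fintype.split j with
  | inl i => if unlift ord0 i is Some i' then affine_op (alpha i') (beta i') b
             else b
  | inr k => derive1n k.+1 b
  end.

(* Main.v *)
Require Import Defs.
From mathcomp Require Import all_boot all_order all_algebra.
From mathcomp Require Import complex.
From mathcomp Require Import all_classical all_reals all_analysis.
From mathcomp Require Import -(notations) mpoly.
From mathcomp Require Import zify ring lra.

(** The functions that satisfy an algebraic differential equation over C(z)
    are stable under all the operations that build the left-hand side of the
    functional equation; so if [b] were differentially algebraic, [a] would be.

    Why they are stable.  Let [b] satisfy p(z, b, ..., b^(k)) = 0 and let S be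
    the partial derivative of p with respect to the last derivative of [b] that
    occurs in p (the separant).  Differentiating the equation expresses the next
    derivative of [b] polynomially in terms of z, b, ..., b^(k) and 1 / S.
    Hence, on an open set where S does not vanish, [b] belongs to an algebra of
    functions that is finitely generated over C and closed under
    differentiation; call such functions tame.  Tame functions are visibly
    closed under sums, products, inverses and derivatives, and b (alpha z + beta)
    is tame for the same reason as [b].  Conversely a tame function [h] is
    differentially algebraic: all its derivatives are polynomials in M
    generators, and M + 1 polynomials in M variables are algebraically
    dependent ([algebraic_dependence], a dimension count).

    It remains to deal with the zeros of S ([covered_tame]).  Either S vanishes
    identically on an open set, where it is an equation for [b] of smaller
    degree, or it is nonzero on an open set; up to a nowhere dense set the
    domain is the union of these two parts, and by induction on the degree it is
    finitely covered by open sets on which [b] is tame.  The relations found for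
    [a] on the finitely many pieces are multiplied together, and their product
    vanishes everywhere by continuity ([covered_diff_algebraic_on]).

    All of this takes place on an open set that meets every punctured
    neighbourhood and on which the functions are holomorphic.  The derivatives
    must themselves be differentiable there: this is [derivable_derive1], proved
    from Goursat's theorem for squares.  Goursat's theorem is stated for
    functions that are differentiable except at one point, where they are only
    continuous; applied to a difference quotient, it gives Cauchy's formula
    f(w) * I(1)(w) = I(f)(w), where I(phi)(w) is the boundary integral of
    phi(z) / (z - w).  Differentiation under the integral sign shows that I(f)
    and I(1) are twice differentiable, and I(1) does not vanish at the center of
    the square, so their quotient f is twice differentiable there. *)

Set Implicit Arguments.
Unset Strict Implicit.
Unset Printing Implicit Defensive.

Import Order.TTheory GRing.Theory Num.Theory.
Import numFieldNormedType.Exports.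
Import Normc.

Local Open Scope classical_set_scope.
Local Open Scope ring_scope.
(** * Pointwise calculus over a number field *)

Lemma is_derive_affine (K : numFieldType) (a b x : K) :
  is_derive x 1 (fun t => a * t + b) a.
Proof.
rewrite -[X in is_derive _ _ _ X](addr0 a) -[X in is_derive _ _ _ (X + _)]mulr1.
exact: is_deriveD.
Qed.

Lemma is_derive_comp_affine (K : numFieldType) (f : K -> K) (a b x l : K) :
  is_derive (a * x + b) 1 f l -> is_derive x 1 (fun t => f (a * t + b)) (a * l).
Proof.
move=> [df fl]; pose g (t : K) := a * t + b.
have [dg gl] : is_derive x 1 g a by exact: is_derive_affine.
have dg' : differentiable g x by exact/derivable1_diffP.
have df' : differentiable f (g x) by exact/derivable1_diffP.
have dfg : differentiable (f \o g) x by exact: differentiable_comp.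
split; first exact/derivable1_diffP.
have dg1 : 'd g x 1 = a by rewrite -gl; exact/esym/deriveE.
rewrite (deriveE _ dfg) (diff_comp dg' df').
transitivity ('d f (g x) a); first exact: (congr1 ('d f (g x)) dg1).
by rewrite (deriv1E df) derive1E fl.
Qed.

Lemma continuous_at_add (K : numFieldType) (f g : K -> K) (z : K) :
  {for z, continuous f} -> {for z, continuous g} ->
  {for z, continuous (fun u => f u + g u)}.
Proof. by move=> cf cg; exact: (cvgD cf cg). Qed.

Lemma continuous_at_mul (K : numFieldType) (f g : K -> K) (z : K) :
  {for z, continuous f} -> {for z, continuous g} ->
  {for z, continuous (fun u => f u * g u)}.
Proof. by move=> cf cg; exact: (cvgM cf cg). Qed.

Lemma continuous_at_cst (K : numFieldType) (z c : K) : {for z, continuous (fun=> c)}.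
Proof. exact: (@cst_continuous K K c). Qed.

Lemma continuous_at_inv (K : numFieldType) (f : K -> K) (z : K) : f z != 0 ->
  {for z, continuous f} -> {for z, continuous (fun u => (f u)^-1)}.
Proof. by move=> fz cf; exact: (cvgV fz cf). Qed.

Lemma nbhs_neq (K : numFieldType) (z w : K) :
  z != w -> \forall u \near z, u != w.
Proof.
move=> zw; apply/nbhs_ballP; exists `|z - w|; first by rewrite /= normr_gt0 subr_eq0.
by move=> u; rewrite -ball_normE /=; apply: contraTneq => ->; rewrite ltxx.
Qed.

Lemma continuous_at_neq0 (K : numFieldType) (f : K -> K) (z : K) :
  {for z, continuous f} -> f z != 0 -> \forall u \near z, f u != 0.
Proof. by move=> cf fz; exact: (cf _ (nbhs_neq fz)). Qed.

Lemma near_eq_derive1 (K : numFieldType) (f g : K -> K) (z : K) :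
  (\forall u \near z, f u = g u) -> derive1 f z = derive1 g z.
Proof. by move=> fg; rewrite !derive1E; exact: near_eq_derive. Qed.

(** If F = f * G and the derivatives F', G' of F and G are differentiable at
    [c], then so is the derivative of f, by the quotient rule near [c]. *)
Lemma derivable_derive1_quotient (K : numFieldType) (F G F' G' f : K -> K) (c : K) :
  (\forall w \near c, is_derive w (1 : K) F (F' w)) ->
  (\forall w \near c, is_derive w (1 : K) G (G' w)) ->
  derivable F' c 1 -> derivable G' c 1 -> G c != 0 ->
  (\forall w \near c, F w = f w * G w) -> derivable (derive1 f) c 1.
Proof.
move=> dF dG dF' dG' Gc FfG.
have [dFc _] := nbhs_singleton dF; have [dGc _] := nbhs_singleton dG.
have G0 : \forall w \near c, G w != 0.
  apply: continuous_at_neq0 Gc; exact/differentiable_continuous/derivable1_diffP.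
have fFG : \forall w \near c, F w * (G w)^-1 = f w.
  by apply: filterS2 FfG G0 => w -> Gw; rewrite mulfK.
have d1 : \forall w \near c,
    F w * (- (G w) ^- 2 * G' w) + (G w)^-1 * F' w = derive1 f w.
  apply: filterS3 (near_join fFG) (filterI dF dG) G0 => w fw [dFw' dGw'] Gw.
  rewrite -(near_eq_derive1 fw) derive1E.
  have [dFw F'w] := dFw'; have [dGw G'w] := dGw'.
  by rewrite (deriveM dFw (derivableV Gw dGw)) F'w (deriveV Gw dGw) G'w.
apply: (near_eq_derivable d1).
have dVc : derivable (fun w => (G w)^-1) c 1 by exact: derivableV.
apply: derivableD; last exact: derivableM dVc dF'.
apply: (derivableM dFc); apply: derivableM dG'; apply: derivableN.
rewrite (_ : (fun w => (G w) ^- 2) = (fun w => (G w)^-1) * (fun w => (G w)^-1)).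
  exact: derivableM.
by apply/funext => w; rewrite expr2 invfM.
Qed.

Lemma continuous_affine (K : numFieldType) (a b : K) :
  continuous (fun z : K => a + b * z).
Proof.
move=> z; apply: continuous_at_add; first exact: continuous_at_cst.
by apply: (@continuous_at_mul K (fun=> b) id); [exact: continuous_at_cst|exact: cvg_id].
Qed.

Lemma continuous_sub_affine (K : numFieldType) (g : K -> K) (a b : K) :
  continuous g -> continuous (fun z => g z - (a + b * z)).
Proof.
move=> cg z; rewrite (_ : (fun z => _) = fun z => g z + (- a + - b * z)).
  by apply: (@continuous_at_add K g (fun z => - a + - b * z)); [exact: cg|exact: continuous_affine].
by apply/funext => u; rewrite opprD mulNr.
Qed.

(** * Integration over the unit interval *)

Section RealIntegral.
Variable R : realType.
Implicit Types (u v U V : R -> R).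

(** Continuous functions have antiderivatives on an open interval containing
    [0, 1], and all the rules of integration below are obtained by comparing
    antiderivatives ([int01_FTC]). *)
Definition int01 u : R := (\int[lebesgue_measure]_(t in `[0, 1]) u t)%R.

Lemma antiderivative_exists u : continuous u ->
  exists U : R -> R, forall t : R, -1 < t < 2 -> is_derive t 1 U (u t).
Proof.
move=> cu.
exists (fun t : R => (\int[lebesgue_measure]_(s in [set` `[-2, t]]) u s)%R) => t /andP[t1 t2].
have iu : lebesgue_measure.-integrable `[-2, 2] (EFin \o u).
  apply: continuous_compact_integrable; first exact: segment_compact.
  exact: continuous_subspaceT.
have t2' : -2 < t by apply: lt_trans t1; rewrite ltrN2 ltr1n.
have [dU Ut] := continuous_FTC1_closed t2 iu t2' (cu t).
by split; [exact: dU|rewrite -derive1E].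
Qed.

Lemma int01_FTC U u : continuous u ->
  (forall t : R, -1 < t < 2 -> is_derive t 1 U (u t)) -> int01 u = U 1 - U 0.
Proof.
move=> cu dU; rewrite /int01 /Rintegral.
have I (t : R) : 0 <= t <= 1 -> -1 < t < 2.
  by move=> /andP[t0 t1]; apply/andP; split; lra.
rewrite (@continuous_FTC2 _ u U) ?ltr01//.
- exact: continuous_subspaceT.
- have cU (t : R) : 0 <= t <= 1 -> {for t, continuous U}.
    move=> /I/dU[dt _]; exact/differentiable_continuous/derivable1_diffP.
  split.
  + by move=> t /[!in_itv]/= /andP[t0 t1]; have [] := dU t (I _ _) => //; rewrite !ltW.
  + by apply: cvg_at_right_filter; apply: cU; rewrite lexx ler01.
  + by apply: cvg_at_left_filter; apply: cU; rewrite lexx ler01.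
- move=> t /[!in_itv]/= /andP[t0 t1]; rewrite derive1E.
  by have [] := dU t (I _ _) => //; rewrite !ltW.
Qed.

Lemma int01_mean u : continuous u -> exists2 t : R, 0 < t < 1 & int01 u = u t.
Proof.
move=> cu; have [U dU] := antiderivative_exists cu.
rewrite (int01_FTC cu dU).
have [] := @MVT _ U u 0 1 ltr01.
- by move=> t /[!in_itv]/= /andP[t0 t1]; apply: dU; lra.
- apply: derivable_within_continuous => t /[!in_itv]/= /andP[t0 t1].
  have : -1 < t < 2 by lra.
  by move=> /dU[].
by move=> t /[!in_itv]/= t01 ->; exists t; rewrite // subr0 mulr1.
Qed.

Lemma continuous_comp_affine u (a b : R) :
  continuous u -> continuous (fun t => u (a * t + b)).
Proof.
move=> cu t; apply: continuous_comp; last exact: cu.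
by apply: cvgD; [apply: cvgM; [exact: cvg_cst|exact: cvg_id]|exact: cvg_cst].
Qed.

Lemma int01_lin (c d : R) u v : continuous u -> continuous v ->
  int01 (fun t => c * u t + d * v t) = c * int01 u + d * int01 v.
Proof.
move=> cu cv; have [U dU] := antiderivative_exists cu.
have [V dV] := antiderivative_exists cv.
have cw : continuous (fun t => c * u t + d * v t).
  by move=> t; apply: cvgD; apply: cvgM; by [exact: cvg_cst|exact: cu|exact: cv].
have dW (t : R) : -1 < t < 2 ->
    is_derive t 1 (fun t => c * U t + d * V t) (c * u t + d * v t).
  move=> tI; have dUt := dU t tI; have dVt := dV t tI.
  by apply: is_deriveD; apply: is_deriveZ.
rewrite (int01_FTC cu dU) (int01_FTC cv dV) (int01_FTC cw dW).
by ring.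
Qed.

Lemma int01_half u : continuous u ->
  int01 (fun t => u (2^-1 * t + 0)) + int01 (fun t => u (2^-1 * t + 2^-1))
    = 2 * int01 u.
Proof.
move=> cu; have [U dU] := antiderivative_exists cu.
have dW b (t : R) : -1 < 2^-1 * t + b < 2 ->
    is_derive t 1 (fun t => 2 * U (2^-1 * t + b)) (u (2^-1 * t + b)).
  move=> tI; rewrite -[u _](mulKf (_ : 2 != 0))// mulrCA.
  by apply: is_deriveZ; apply: is_derive_comp_affine; exact: dU.
have W b : 0 <= b <= 2^-1 ->
    int01 (fun t => u (2^-1 * t + b)) = 2 * U (2^-1 * 1 + b) - 2 * U (2^-1 * 0 + b).
  move=> b01; have dWb (t : R) : -1 < t < 2 ->
      is_derive t 1 (fun t => 2 * U (2^-1 * t + b)) (u (2^-1 * t + b)).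
    by move=> t12; apply: dW; lra.
  by rewrite (int01_FTC (continuous_comp_affine cu) dWb).
rewrite (int01_FTC cu dU) !W; [|by apply/andP; split; lra..].
rewrite mulr0 mulr1 !addr0 add0r.
have -> : 2^-1 + 2^-1 = 1 :> R by lra.
ring.
Qed.

Lemma int01_rev u : continuous u -> int01 (fun t => u (-1 * t + 1)) = int01 u.
Proof.
move=> cu; have [U dU] := antiderivative_exists cu.
have dW (t : R) : -1 < t < 2 ->
    is_derive t 1 (fun t => -1 * U (-1 * t + 1)) (u (-1 * t + 1)).
  move=> tI; rewrite (_ : u (-1 * t + 1) = -1 * (-1 * u (-1 * t + 1))); last by ring.
  by apply: is_deriveZ; apply: is_derive_comp_affine; apply: dU; lra.
rewrite (int01_FTC cu dU) (int01_FTC (continuous_comp_affine (b := 1) cu) dW).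
rewrite mulr1 addNr mulr0 add0r; ring.
Qed.

Lemma int01_cst (c : R) : int01 (fun=> c) = c.
Proof.
have dW (t : R) : -1 < t < 2 -> is_derive t 1 (fun t => c * t) c.
  by move=> _; rewrite -[X in is_derive _ _ _ X]mulr1; exact: is_deriveZ.
rewrite (int01_FTC _ dW); first by rewrite mulr1 mulr0 subr0.
by move=> t; exact: cvg_cst.
Qed.

Lemma int01_id : int01 id = 2^-1.
Proof.
have dW (t : R) : -1 < t < 2 -> is_derive t 1 (fun t => 2^-1 * (t * t)) t.
  move=> _; rewrite [X in is_derive _ _ _ X](_ : _ = 2^-1 *: (t *: 1 + t *: 1)).
    by apply: is_deriveZ; apply: is_deriveM.
  by rewrite /GRing.scale/=; field.
rewrite (int01_FTC _ dW); first by rewrite !mulr1 !mulr0 subr0.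
by move=> t; exact: cvg_id.
Qed.

End RealIntegral.

(** * Complex line integrals *)

Section ComplexPlane.
Variable R : realType.
Local Notation C := (Cplx R).
Implicit Types (z w : C).

Lemma nbhs_normcP z (A : set C) :
  nbhs z A <-> exists2 e : R, 0 < e & forall w, normc (w - z) < e -> A w.
Proof.
split.
- move=> /nbhs_ballP[[e1 e2] /=]; rewrite ltcE /= => /andP[/eqP e20 e10] eA.
  exists e1 => // w we; apply: eA.
  by rewrite -ball_normE /= distrC e20 ltcR.
- case=> e e0 eA; apply/nbhs_ballP; exists (e%:C)%C => /=.
    by rewrite (ltcR 0).
  move=> w; rewrite -ball_normE /= distrC => we; apply: eA.
  by move: we; rewrite ltcR.
Qed.

Lemma normc_Re z : `|complex.Re z| <= normc z.
Proof. by have := normc_ge_Re z; rewrite lecR. Qed.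

Lemma normc_Im z : `|complex.Im z| <= normc z.
Proof.
case: z => a b /=; rewrite -sqrtr_sqr ler_sqrt ?addr_ge0 ?sqr_ge0//.
by rewrite lerDr sqr_ge0.
Qed.

Lemma normc_le z : normc z <= `|complex.Re z| + `|complex.Im z|.
Proof.
case: z => a b /=.
rewrite -[leRHS]ger0_norm ?addr_ge0// -sqrtr_sqr ler_sqrt ?sqr_ge0//.
rewrite sqrrD !real_normK ?num_real// addrAC lerDl mulrn_wge0 ?mulr_ge0//.
Qed.

Lemma continuous_complex (T : topologicalType) (u v : T -> R) (x : T) :
  {for x, continuous u} -> {for x, continuous v} ->
  {for x, continuous (fun t => (u t +i* v t)%C : C)}.
Proof.
move=> cu cv A /nbhs_normcP[e e0 eA].
have e20 : 0 < e / 2 by rewrite divr_gt0.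
move/cvgrPdist_lt : cu => /(_ _ e20) cu.
move/cvgrPdist_lt : cv => /(_ _ e20) cv.
apply: filterS2 cu cv => t ut vt; apply: eA.
apply: le_lt_trans (normc_le _) _ => /=.
by rewrite [ltRHS]splitr distrC [`|v t - _|]distrC ltrD.
Qed.

Lemma continuous_Re : continuous (fun z : C => complex.Re z).
Proof.
move=> z A /nbhs_ballP[e /= e0 eA]; apply/nbhs_normcP; exists e => // w we.
apply: eA; rewrite -ball_normE /=; apply: le_lt_trans we; rewrite distrC.
by have := normc_Re (w - z); case: w => ? ?; case: z => ? ?.
Qed.

Lemma continuous_Im : continuous (fun z : C => complex.Im z).
Proof.
move=> z A /nbhs_ballP[e /= e0 eA]; apply/nbhs_normcP; exists e => // w we.
apply: eA; rewrite -ball_normE /=; apply: le_lt_trans we; rewrite distrC.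
by have := normc_Im (w - z); case: w => ? ?; case: z => ? ?.
Qed.

(** Integrating the real and imaginary parts separately keeps the theory within
    real calculus: a complex function of a real variable has no derivative over
    the field of complex numbers. *)
Definition cint (phi : R -> C) : C :=
  (int01 (fun t => complex.Re (phi t)) +i* int01 (fun t => complex.Im (phi t)))%C.

Lemma continuous_Re_comp (phi : R -> C) :
  continuous phi -> continuous (fun t => complex.Re (phi t)).
Proof.
by move=> cphi t; apply: (continuous_comp (@cphi t)); exact: continuous_Re.
Qed.

Lemma continuous_Im_comp (phi : R -> C) :
  continuous phi -> continuous (fun t => complex.Im (phi t)).
Proof.
by move=> cphi t; apply: (continuous_comp (@cphi t)); exact: continuous_Im.
Qed.

Lemma cintD (phi psi : R -> C) : continuous phi -> continuous psi ->
  cint (fun t => phi t + psi t) = cint phi + cint psi.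
Proof.
move=> cf cg; rewrite /cint.
transitivity (int01 (fun t => 1 * complex.Re (phi t) + 1 * complex.Re (psi t)) +i*
  int01 (fun t => 1 * complex.Im (phi t) + 1 * complex.Im (psi t)))%C.
  by congr (_ +i* _)%C; congr int01; apply/funext => t; rewrite !mul1r;
     case: (phi t) => ? ?; case: (psi t).
rewrite !int01_lin ?mul1r//.
- exact: continuous_Im_comp.
- exact: continuous_Im_comp.
- exact: continuous_Re_comp.
- exact: continuous_Re_comp.
Qed.

Lemma cintZ (c : C) (phi : R -> C) : continuous phi ->
  cint (fun t => c * phi t) = c * cint phi.
Proof.
move=> cf; rewrite /cint; case: c => c1 c2.
transitivity (int01 (fun t => c1 * complex.Re (phi t) + (- c2) * complex.Im (phi t)) +i*
  int01 (fun t => c1 * complex.Im (phi t) + c2 * complex.Re (phi t)))%C.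
  by congr (_ +i* _)%C; congr int01; apply/funext => t;
     case: (phi t) => a b //=; rewrite mulNr.
rewrite !int01_lin.
- by apply/eqP; rewrite eq_complex /= mulNr !eqxx.
- exact: continuous_Im_comp.
- exact: continuous_Re_comp.
- exact: continuous_Re_comp.
- exact: continuous_Im_comp.
Qed.

(** Componentwise use of the mean value theorem costs the factor 2. *)
Lemma cint_norm (phi : R -> C) (M : R) : continuous phi ->
  (forall t : R, 0 <= t <= 1 -> normc (phi t) <= M) -> normc (cint phi) <= 2 * M.
Proof.
move=> cf fM; apply: le_trans (normc_le _) _ => /=.
have [t t01 ->] := int01_mean (continuous_Re_comp cf).
have [s s01 ->] := int01_mean (continuous_Im_comp cf).
rewrite mulr_natl mulr2n lerD//.
  by apply: le_trans (normc_Re _) _; apply: fM; lra.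
by apply: le_trans (normc_Im _) _; apply: fM; lra.
Qed.

Lemma cint_half (phi : R -> C) : continuous phi ->
  cint (fun t => phi (2^-1 * t + 0)) + cint (fun t => phi (2^-1 * t + 2^-1))
    = 2 * cint phi.
Proof.
move=> cf; have re := int01_half (continuous_Re_comp cf).
have im := int01_half (continuous_Im_comp cf).
rewrite /cint -[LHS]/(_ +i* _)%C re im.
by rewrite [RHS]mulr_natl [RHS]mulr2n -[RHS]/(_ +i* _)%C !mulr_natl !mulr2n.
Qed.

Lemma cint_rev (phi : R -> C) : continuous phi ->
  cint (fun t => phi (-1 * t + 1)) = cint phi.
Proof.
move=> cf; rewrite /cint (int01_rev (continuous_Re_comp cf)).
by rewrite (int01_rev (continuous_Im_comp cf)).
Qed.

Lemma cint_cst (c : C) : cint (fun=> c) = c.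
Proof. by rewrite /cint !int01_cst; case: c. Qed.

Lemma real_complex_half : (2^-1 : R)%:C%C = 2^-1 :> C.
Proof. by rewrite (fmorphV (real_complex R)) rmorph_nat. Qed.

Lemma cint_id : cint (fun t => t%:C%C) = 2^-1.
Proof.
by rewrite /cint int01_id int01_cst -real_complex_half.
Qed.

Definition segment (A q : C) (t : R) : C := A + t%:C%C * q.

Lemma continuous_real_complex : continuous (fun t : R => t%:C%C : C).
Proof. by move=> t; apply: continuous_complex; [exact: cvg_id|exact: cvg_cst]. Qed.

Lemma continuous_segment A q : continuous (segment A q).
Proof.
move=> t; apply: cvgD; first exact: cvg_cst.
by apply: cvgM; [exact: continuous_real_complex|exact: cvg_cst].
Qed.

Definition seg_int (g : C -> C) (A q : C) : C := q * cint (g \o segment A q).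

(** The integrand may have poles off the segment, so that only continuity along
    the line through it is required. *)
Definition seg_continuous (g : C -> C) (A q : C) := continuous (g \o segment A q).

Lemma continuous_seg_continuous g A q : continuous g -> seg_continuous g A q.
Proof.
by move=> cg t; apply: continuous_comp; [exact: continuous_segment|exact: cg].
Qed.

Lemma seg_intD g h A q : seg_continuous g A q -> seg_continuous h A q ->
  seg_int (fun z => g z + h z) A q = seg_int g A q + seg_int h A q.
Proof.
move=> cg ch; rewrite /seg_int -mulrDr; congr (q * _).
exact: (cintD cg ch).
Qed.

Lemma seg_intZ c g A q : seg_continuous g A q ->
  seg_int (fun z => c * g z) A q = c * seg_int g A q.
Proof.
move=> cg; rewrite /seg_int mulrCA; congr (q * _).
exact: (cintZ c cg).
Qed.

Lemma seg_int_norm g A q (M : R) : seg_continuous g A q ->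
  (forall t : R, 0 <= t <= 1 -> normc (g (segment A q t)) <= M) ->
  normc (seg_int g A q) <= normc q * (2 * M).
Proof.
move=> cg gM; rewrite /seg_int normcM ler_wpM2l//; last exact: cint_norm.
by case: (q) => a b /=; rewrite sqrtr_ge0.
Qed.

Lemma seg_int_split g A q : seg_continuous g A q ->
  seg_int g A q = seg_int g A (q / 2) + seg_int g (A + q / 2) (q / 2).
Proof.
move=> cg; rewrite /seg_int -mulrDr.
have := cint_half cg => /=.
have C2 : 2 != 0 :> C by rewrite pnatr_eq0.
have r2 := real_complex_half.
rewrite (_ : (fun t => _) = g \o segment A (q / 2)); last first.
  apply/funext => t /=; congr g; rewrite /segment rmorphD rmorphM/= r2 rmorph0; ring.
rewrite (_ : (fun t => g (segment A q (_ + 2^-1))) = g \o segment (A + q / 2) (q / 2)); last first.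
  apply/funext => t /=; congr g; rewrite /segment rmorphD rmorphM/= r2; ring.
by move=> ->; rewrite mulrA divfK.
Qed.

Lemma seg_int_rev g A q : seg_continuous g A q ->
  seg_int g (A + q) (- q) = - seg_int g A q.
Proof.
move=> cg; rewrite /seg_int mulNr -(cint_rev cg); congr (- (_ * cint _)).
apply/funext => t /=; congr g.
rewrite /segment rmorphD rmorphM rmorphN /= rmorph1; ring.
Qed.

Lemma seg_int_affine (a b A q : C) :
  seg_int (fun z => a + b * z) A q = a * q + b * (A * q + q ^+ 2 / 2).
Proof.
rewrite /seg_int.
rewrite (_ : _ \o _ = fun t => (a + b * A) + (b * q) * t%:C%C); last first.
  by apply/funext => t; rewrite /segment /=; ring.
rewrite cintD; last 2 first.
- by move=> t; exact: cvg_cst.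
- by move=> t; apply: cvgM; [exact: cvg_cst|exact: continuous_real_complex].
rewrite cintZ; last exact: continuous_real_complex.
by rewrite cint_cst cint_id; field.
Qed.

(** * Integrals over boundaries of squares *)

Local Notation i1 := ('i : complex R)%C.

(** Integral over the boundary of the square with lower left corner [A] and
    side [s], counterclockwise. *)
Definition sq_int (g : C -> C) (A s : C) : C :=
  seg_int g A s + seg_int g (A + s) (i1 * s)
  + seg_int g (A + s + i1 * s) (- s) + seg_int g (A + i1 * s) (- (i1 * s)).

Definition sq_continuous (g : C -> C) (A s : C) :=
  [/\ seg_continuous g A s, seg_continuous g (A + s) (i1 * s),
      seg_continuous g (A + s + i1 * s) (- s)
    & seg_continuous g (A + i1 * s) (- (i1 * s))].

Lemma continuous_sq_continuous g A s : continuous g -> sq_continuous g A s.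
Proof. by move=> cg; split; exact: continuous_seg_continuous. Qed.

Lemma sq_intD g h A s : sq_continuous g A s -> sq_continuous h A s ->
  sq_int (fun z => g z + h z) A s = sq_int g A s + sq_int h A s.
Proof.
move=> [g1 g2 g3 g4] [h1 h2 h3 h4].
rewrite /sq_int (seg_intD g1 h1) (seg_intD g2 h2) (seg_intD g3 h3) (seg_intD g4 h4).
ring.
Qed.

Lemma sq_intZ c g A s : sq_continuous g A s ->
  sq_int (fun z => c * g z) A s = c * sq_int g A s.
Proof.
move=> [g1 g2 g3 g4].
rewrite /sq_int (seg_intZ c g1) (seg_intZ c g2) (seg_intZ c g3) (seg_intZ c g4).
ring.
Qed.

Lemma sq_int_affine a b A s : sq_int (fun z => a + b * z) A s = 0.
Proof. by rewrite /sq_int !seg_int_affine; field. Qed.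

(** The four boundaries of the quarters traverse each inner side twice, in
    opposite directions. *)
Lemma sq_int_split g A s : continuous g ->
  sq_int g A s = sq_int g A (s / 2) + sq_int g (A + s / 2) (s / 2)
    + sq_int g (A + i1 * (s / 2)) (s / 2)
    + sq_int g (A + i1 * (s / 2) + s / 2) (s / 2).
Proof.
move=> cg; have cs A' q := @continuous_seg_continuous g A' q cg.
rewrite /sq_int; set h := s / 2; have -> : s = h + h by rewrite /h; field.
have sp A' q : seg_int g A' (q + q) = seg_int g A' q + seg_int g (A' + q) q.
  rewrite (seg_int_split (cs _ _)); have -> : (q + q) / 2 = q by field.
  by [].
have rv A' q := seg_int_rev (cs A' q).
rewrite mulrDr !opprD !sp.
have -> : A + (h + h) + (i1 * h + i1 * h) - h = A + i1 * h + h + i1 * h by ring.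
have -> : A + (i1 * h + i1 * h) - i1 * h = A + i1 * h by ring.
have e1 := rv (A + i1 * h) h.
have e2 := rv (A + h) (i1 * h).
have e3 := rv (A + i1 * h + h) h.
have e4 := rv (A + i1 * h + h) (i1 * h).
have -> : A + h + i1 * h = A + i1 * h + h by ring.
have -> : A + h + h + i1 * h = A + i1 * h + h + h by ring.
rewrite (_ : A + h + i1 * h = A + i1 * h + h) in e2; last by ring.
rewrite e1 e2 e3 e4.
have -> : A + (h + h) = A + h + h by ring.
have -> : A + h + h + i1 * h = A + i1 * h + h + h by ring.
have -> : A + h + h + (i1 * h + i1 * h) = A + i1 * h + h + h + i1 * h by ring.
have -> : A + (i1 * h + i1 * h) = A + i1 * h + i1 * h by ring.
ring.
Qed.

Definition in_sq (x y s : R) (z : C) :=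
  (x <= complex.Re z <= x + s) && (y <= complex.Im z <= y + s).

(** The lines carrying the sides rather than the sides themselves: integrands are
    continuous along whole parametrized lines, while bounds use both [sq_edge]
    and [in_sq]. *)
Definition sq_edge (x y s : R) (z : C) :=
  [\/ complex.Re z = x, complex.Re z = x + s, complex.Im z = y
    | complex.Im z = y + s].

Lemma sq_edge_segment (x y s t : R) :
  let A := (x +i* y)%C in let q := (s%:C)%C in
  [/\ sq_edge x y s (segment A q t), sq_edge x y s (segment (A + q) (i1 * q) t),
      sq_edge x y s (segment (A + q + i1 * q) (- q) t)
    & sq_edge x y s (segment (A + i1 * q) (- (i1 * q)) t)].
Proof.
move=> A q; split; [apply: Or43|apply: Or42|apply: Or44|apply: Or41];
rewrite /segment /A /q /= !(mul0r, mulr0, subr0, addr0, add0r, sub0r, mul1r, mulrN, oppr0);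
lra.
Qed.

Lemma sq_boundary (P : C -> Prop) (x y s : R) : 0 <= s ->
  (forall z, in_sq x y s z -> sq_edge x y s z -> P z) ->
  let A := (x +i* y)%C in let q := (s%:C)%C in
  forall t : R, 0 <= t <= 1 ->
  [/\ P (segment A q t), P (segment (A + q) (i1 * q) t),
      P (segment (A + q + i1 * q) (- q) t) & P (segment (A + i1 * q) (- (i1 * q)) t)].
Proof.
move=> s0 sP A q t /andP[t0 t1].
have ts0 : 0 <= t * s by rewrite mulr_ge0.
have ts1 : t * s <= s by rewrite ler_piMl.
have [e1 e2 e3 e4] := sq_edge_segment x y s t.
split; apply: sP => //; rewrite /in_sq /segment /A /q /=;
rewrite !(mul0r, mulr0, subr0, addr0, add0r, sub0r, mul1r, mulrN, oppr0);
by apply/andP; split; apply/andP; split; lra.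
Qed.

Lemma normc_ge0 z : 0 <= normc z.
Proof. by case: z => a b /=; rewrite sqrtr_ge0. Qed.

Lemma normc_real (s : R) : 0 <= s -> normc (s%:C)%C = s.
Proof. by move=> s0 /=; rewrite expr0n/= addr0 sqrtr_sqr ger0_norm. Qed.

Lemma sq_int_norm g (x y s M : R) : 0 <= s ->
  let A := (x +i* y)%C in sq_continuous g A (s%:C)%C ->
  (forall z, in_sq x y s z -> sq_edge x y s z -> normc (g z) <= M) ->
  normc (sq_int g A (s%:C)%C) <= 8 * (M * s).
Proof.
move=> s0 A [g1 g2 g3 g4] gM.
have bd := sq_boundary s0 gM.
have ni : normc i1 = 1 by rewrite /= expr0n/= expr1n add0r sqrtr1.
have n0 := normc_real s0.
have n1 : normc (i1 * (s%:C)%C) = s by rewrite normcM ni mul1r.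
have b1 := seg_int_norm g1 (fun t t01 => let: And4 h _ _ _ := bd t t01 in h).
have b2 := seg_int_norm g2 (fun t t01 => let: And4 _ h _ _ := bd t t01 in h).
have b3 := seg_int_norm g3 (fun t t01 => let: And4 _ _ h _ := bd t t01 in h).
have b4 := seg_int_norm g4 (fun t t01 => let: And4 _ _ _ h := bd t t01 in h).
rewrite ?normcN ?n0 ?n1 in b1 b2 b3 b4.
rewrite /sq_int (le_trans (le_normcD _ _))//.
have -> : 8 * (M * s) = s * (2 * M) + s * (2 * M) + s * (2 * M) + s * (2 * M) by ring.
apply: lerD b4; rewrite (le_trans (le_normcD _ _))//.
apply: lerD b3; rewrite (le_trans (le_normcD _ _))//.
exact: lerD.
Qed.

(** * Goursat's theorem *)

Lemma nested_intervals (a s : nat -> R) : (forall n, 0 <= s n) ->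
  (forall n, a n <= a n.+1) -> (forall n, a n.+1 + s n.+1 <= a n + s n) ->
  exists c, forall n, a n <= c <= a n + s n.
Proof.
move=> s0 ai bi.
have am : {homo a : n m / (n <= m)%N >-> n <= m} by apply: homo_leq => // ? ? ?; exact: le_trans.
have bm : {homo (fun n => a n + s n) : n m / (n <= m)%N >-> m <= n}.
  by apply: homo_leq => // ? ? ? h1 h2; exact: le_trans h2 h1.
have ab n m : a n <= a m + s m.
  have [nm|/ltnW mn] := leqP n m.
    by rewrite (le_trans (am _ _ nm))// lerDl.
  by rewrite (le_trans _ (bm _ _ mn))//= lerDl.
exists (sup (range a)) => n; apply/andP; split.
  by apply: ub_le_sup; [exists (a 0 + s 0) => _ [m _ <-]; exact: ab|exists n].
by apply: ge_sup; [exists (a 0), 0|move=> _ [m _ <-]; exact: ab].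
Qed.

Lemma exists_half_pow_lt (s d : R) : 0 <= s -> 0 < d -> exists n, s / 2 ^+ n < d.
Proof.
move=> s0 d0; exists (Num.bound (s / d)).
rewrite ltr_pdivrMr ?exprn_gt0// mulrC -ltr_pdivrMr//.
apply: (lt_trans (archi_boundP _)); first by rewrite divr_ge0// ltW.
by rewrite -natrX ltr_nat ltn_expl.
Qed.

(** The bisection method: a property of squares that passes to one of the four
    quarters holds for arbitrarily small squares around some point. *)
Lemma bisection (bad : R -> R -> R -> Prop) (x0 y0 s0 : R) : 0 <= s0 ->
  (forall x y s, 0 <= s -> bad x y s ->
    exists x' y', [/\ x' = x \/ x' = x + s / 2, y' = y \/ y' = y + s / 2
      & bad x' y' (s / 2)]) ->
  bad x0 y0 s0 ->
  exists z, in_sq x0 y0 s0 z /\ forall d, 0 < d -> exists x y s,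
    [/\ bad x y s, 0 <= s < d, in_sq x y s z
      & forall w, in_sq x y s w -> in_sq x0 y0 s0 w].
Proof.
move=> s00 step bad0.
pose ok (p q : R * R * R) := q.2 = p.2 / 2 /\
  [/\ q.1.1 = p.1.1 \/ q.1.1 = p.1.1 + p.2 / 2,
      q.1.2 = p.1.2 \/ q.1.2 = p.1.2 + p.2 / 2
    & bad q.1.1 q.1.2 q.2].
have : forall p : R * R * R, exists q, 0 <= p.2 -> bad p.1.1 p.1.2 p.2 -> ok p q.
  move=> [[x y] s] /=; case: (pselect (0 <= s /\ bad x y s)).
    move=> [s_ge0 /(step _ _ _ s_ge0)[x' [y' [h1 h2 h3]]]].
    by exists (x', y', s / 2).
  by move=> h; exists (x, y, s) => ? ?; case: h.
move=> /choice[next nextP].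
pose q n := iter n next (x0, y0, s0).
have qP n : (q n).2 = s0 / 2 ^+ n /\ bad (q n).1.1 (q n).1.2 (q n).2.
  elim: n => [|n [IH1 IH2]]; first by rewrite expr0 divr1.
  have [|e [_ _ b]] := nextP (q n) _ IH2; first by rewrite IH1 divr_ge0// exprn_ge0.
  by split=> //; rewrite [LHS]e IH1 exprS invfM; ring.
have qs n : 0 <= (q n).2 by rewrite (qP n).1 divr_ge0// exprn_ge0.
have qS n : ok (q n) (q n.+1) by apply: nextP => //; case: (qP n).
have qx n : (q n).1.1 <= (q n.+1).1.1 /\
            (q n.+1).1.1 + (q n.+1).2 <= (q n).1.1 + (q n).2.
  have [-> [h _ _]] := qS n; have := qs n; case: h => ->; split; lra.
have qy n : (q n).1.2 <= (q n.+1).1.2 /\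
            (q n.+1).1.2 + (q n.+1).2 <= (q n).1.2 + (q n).2.
  have [-> [_ h _]] := qS n; have := qs n; case: h => ->; split; lra.
have [a ax] := nested_intervals qs (fun n => (qx n).1) (fun n => (qx n).2).
have [b by'] := nested_intervals qs (fun n => (qy n).1) (fun n => (qy n).2).
have sub n w : in_sq (q n).1.1 (q n).1.2 (q n).2 w -> in_sq x0 y0 s0 w.
  elim: n => // n IH /andP[/andP[h1 h2] /andP[h3 h4]]; apply: IH.
  have [? ?] := qx n; have [? ?] := qy n.
  by apply/andP; split; apply/andP; split; lra.
exists (a +i* b)%C; split; first by apply/andP; split; [exact: (ax 0)|exact: (by' 0)].
move=> d d0; have [n nd] := exists_half_pow_lt s00 d0.
exists (q n).1.1, (q n).1.2, (q n).2; split.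
- by case: (qP n).
- by rewrite qs (qP n).1.
- by apply/andP; split; [exact: ax|exact: by'].
- exact: sub.
Qed.

(** x |-> sgn (x - c) * sqrt |x - c|. *)
Definition ssqrt (c x : R) : R :=
  if c <= x then Num.sqrt (x - c) else - Num.sqrt (c - x).

(** A nonnegative additive function of squares that is at least the side of any
    square containing the point [w].  The increment of [ssqrt c] over an interval
    of length s containing c is at least sqrt s, so the product of the increments
    in the two coordinates is at least s. *)
Definition weight (w : C) (x y s : R) : R :=
  (ssqrt (complex.Re w) (x + s) - ssqrt (complex.Re w) x) *
  (ssqrt (complex.Im w) (y + s) - ssqrt (complex.Im w) y).

Lemma ssqrt_le c x y : x <= y -> ssqrt c x <= ssqrt c y.
Proof.
move=> xy; rewrite /ssqrt; case: (leP c x) => cx; case: (leP c y) => cy.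
- by rewrite ler_sqrt; lra.
- lra.
- by rewrite (@le_trans _ _ 0)// ?oppr_le0 ?sqrtr_ge0.
- by rewrite lerN2 ler_sqrt; lra.
Qed.

Lemma ssqrt_gap c x s : 0 <= s -> x <= c <= x + s ->
  Num.sqrt s <= ssqrt c (x + s) - ssqrt c x.
Proof.
move=> s0 /andP[xc cxs].
have sub (a b : R) : 0 <= a -> 0 <= b -> Num.sqrt (a + b) <= Num.sqrt a + Num.sqrt b.
  move=> a0 b0; have sa := sqrtr_ge0 a; have sb := sqrtr_ge0 b.
  rewrite -[leRHS]ger0_norm ?addr_ge0// -sqrtr_sqr ler_sqrt ?sqr_ge0//.
  by rewrite sqrrD !sqr_sqrtr// addrAC lerDl mulrn_wge0// mulr_ge0.
rewrite {1}/ssqrt cxs /ssqrt; case: (leP c x) => cx.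
  have -> : c = x by lra.
  by rewrite subrr sqrtr0 subr0 addrC addKr.
by rewrite opprK (le_trans _ (sub _ _ _ _))//; [rewrite ler_sqrt; lra|lra|lra].
Qed.

Lemma weight_ge0 w x y s : 0 <= s -> 0 <= weight w x y s.
Proof. by move=> s0; rewrite mulr_ge0// subr_ge0 ssqrt_le// lerDl. Qed.

Lemma weight_ge_side w x y s : 0 <= s -> in_sq x y s w -> s <= weight w x y s.
Proof.
move=> s0 /andP[xw yw]; rewrite -[leLHS]sqr_sqrtr// expr2.
by rewrite ler_pM ?sqrtr_ge0// ssqrt_gap.
Qed.

Lemma weight_split w x y s :
  weight w x y s = weight w x y (s / 2) + weight w (x + s / 2) y (s / 2)
    + weight w x (y + s / 2) (s / 2) + weight w (x + s / 2) (y + s / 2) (s / 2).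
Proof.
rewrite /weight; have e (u : R) : u + s / 2 + s / 2 = u + s by lra.
rewrite !e; ring.
Qed.

Lemma is_derive_normcP (g : C -> C) (z l : C) : is_derive z 1 g l <->
  forall e : R, 0 < e -> exists2 d : R, 0 < d & forall u, normc (u - z) < d ->
    normc (g u - g z - l * (u - z)) <= e * normc (u - z).
Proof.
split=> [[dg gl] e e0|H].
  have F : (fun h : C => h^-1 *: ((g \o shift z) (h *: 1) - g z)) @ 0^' --> l.
    by rewrite -gl; exact: dg.
  have : nbhs l [set y : C | normc (y - l) < e] by apply/nbhs_normcP; exists e.
  move=> /F /= /nbhs_normcP[d d0 dF]; exists d => // u ud.
  have [->|uz] := eqVneq u z; first by rewrite !subrr mulr0 subr0 normc0 mulr0.
  have h0 : u - z != 0 by rewrite subr_eq0.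
  have := dF (u - z); rewrite subr0 => /(_ ud h0) /=.
  rewrite [_ *: 1]mulr1 subrK => /ltW B.
  have -> : g u - g z - l * (u - z) = ((u - z)^-1 *: (g u - g z) - l) * (u - z).
    by rewrite mulrBl [_ *: _]mulrC mulfVK.
  by rewrite normcM ler_wpM2r ?normc_ge0.
have F : (fun h : C => h^-1 *: ((g \o shift z) (h *: 1) - g z)) @ 0^' --> l.
  move=> A /nbhs_normcP[e e0 eA]; have e20 : 0 < e / 2 by rewrite divr_gt0.
  have [d d0 dH] := H _ e20; apply/nbhs_normcP; exists d => // h hd h0; apply: eA.
  have := dH (h + z); rewrite addrK; rewrite subr0 in hd.
  move=> /(_ hd) B; rewrite /= [h *: 1]mulr1.
  have -> : h^-1 *: (g (h + z) - g z) - l = h^-1 * (g (h + z) - g z - l * h).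
    by rewrite mulrBr mulrCA mulVf// mulr1.
  have nh0 : 0 < normc h.
    rewrite lt_neqAle normc_ge0 andbT eq_sym; apply: contra h0 => /eqP/eq0_normc.
    by move=> ->.
  rewrite normcM normcV mulrC ltr_pdivrMr//; apply: le_lt_trans B _.
  by rewrite ltr_pM2r// ltr_pdivrMr// mulr_natr mulr2n ltrDl.
split; first by apply/cvg_ex; exists l.
exact: (cvg_lim (@norm_hausdorff _ _) F).
Qed.

Lemma in_sq_normc x y s z w : in_sq x y s z -> in_sq x y s w ->
  normc (w - z) <= 2 * s.
Proof.
move=> zin win; apply: le_trans (normc_le _) _; rewrite mulr_natl mulr2n.
case: z w zin win => a b [c d] /andP[/andP[/= ? ?] /andP[/= ? ?]].
move=> /andP[/andP[/= ? ?] /andP[/= ? ?]].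
by apply: lerD; rewrite ler_norml; apply/andP; split; lra.
Qed.

(** Only the deviation of [g] from its first-order expansion contributes. *)
Lemma sq_int_sub_affine (g : C -> C) (a b A s : C) : continuous g ->
  sq_int (fun z => g z - (a + b * z)) A s = sq_int g A s.
Proof.
move=> cg; have ca := continuous_sq_continuous A s (@continuous_affine C (- a) (- b)).
have := sq_intD (continuous_sq_continuous A s cg) ca.
rewrite sq_int_affine addr0 => <-.
suff -> : (fun z => g z - (a + b * z)) = (fun z => g z + (- a + - b * z)) by [].
by apply/funext => z; rewrite opprD mulNr.
Qed.

(** A square on which the integral exceeds [e] times the additive function
    [s ^+ 2 + weight w x y s] has a quarter with the same defect.  Around the
    limit point of the bisection the integral over a square of side s is o(s ^ 2)
    by the first-order expansion of [g], or o(s) by continuity if that point is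
    [w]; both are excluded, the second one because the weight of such a square is
    at least s. *)
Lemma goursat (g : C -> C) (w : C) (x0 y0 s0 : R) : 0 <= s0 -> continuous g ->
  (forall z, in_sq x0 y0 s0 z -> z != w -> derivable g z 1) ->
  sq_int g (x0 +i* y0)%C (s0%:C)%C = 0.
Proof.
move=> s00 cg dg.
pose mu x y s := s ^+ 2 + weight w x y s.
have mu0 x y s : 0 <= s -> 0 <= mu x y s.
  by move=> ?; rewrite addr_ge0 ?sqr_ge0 ?weight_ge0.
pose J x y s := normc (sq_int g (x +i* y)%C (s%:C)%C).
suff H : forall e, 0 < e -> J x0 y0 s0 <= e * mu x0 y0 s0.
  apply: eq0_normc; apply/eqP; rewrite eq_le normc_ge0 andbT.
  apply/ler_addgt0Pr => e e0; rewrite add0r.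
  have m1 : 0 < mu x0 y0 s0 + 1 by rewrite ltr_wpDl// mu0.
  apply: le_trans (H (e / (mu x0 y0 s0 + 1)) _) _; first by rewrite divr_gt0.
  by rewrite mulrAC ler_pdivrMr// ler_pM2l// lerDl.
move=> e e0; rewrite leNgt; apply/negP => bad0.
pose bad x y s := e * mu x y s < J x y s.
have step x y s : 0 <= s -> bad x y s ->
    exists x' y', [/\ x' = x \/ x' = x + s / 2, y' = y \/ y' = y + s / 2
      & bad x' y' (s / 2)].
  move=> s_ge0 bxys; apply: contrapT => nobad.
  have small x' y' : x' = x \/ x' = x + s / 2 -> y' = y \/ y' = y + s / 2 ->
      J x' y' (s / 2) <= e * mu x' y' (s / 2).
    by move=> ? ?; rewrite leNgt; apply/negP => ?; apply: nobad; exists x', y'.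
  move: bxys; rewrite /bad ltNge => /negP; apply.
  rewrite /J (sq_int_split _ _ cg).
  have h2 : s%:C%C / 2 = (s / 2)%:C%C :> C by rewrite rmorphM /= real_complex_half.
  have a1 (a b c : R) : (a +i* b)%C + (c%:C)%C = ((a + c) +i* b)%C.
    by rewrite -[LHS]/(_ +i* _)%C addr0.
  have a2 (a b c : R) : (a +i* b)%C + i1 * (c%:C)%C = (a +i* (b + c))%C.
    by apply/eqP; rewrite eq_complex /= !(mul0r, mulr0, mul1r, subr0, addr0, add0r) !eqxx.
  rewrite !h2 !a2 !a1.
  have -> : e * mu x y s = e * mu x y (s / 2) + e * mu (x + s / 2) y (s / 2)
      + e * mu x (y + s / 2) (s / 2) + e * mu (x + s / 2) (y + s / 2) (s / 2).
    by rewrite /mu (weight_split w x y s); field.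
  apply: le_trans (le_normcD _ _) _; apply: lerD; last by apply: small; right.
  apply: le_trans (le_normcD _ _) _; apply: lerD; last by apply: small; [left|right].
  apply: le_trans (le_normcD _ _) _; apply: lerD; first by apply: small; left.
  by apply: small; [right|left].
have [z [z0 zP]] := bisection s00 step bad0.
suff [d d0 dP] : exists2 d, 0 < d & forall x y s, 0 <= s < d ->
    in_sq x y s z -> J x y s <= e * mu x y s.
  have [x [y [s [bxys sd zin _]]]] := zP d d0.
  by move: bxys; rewrite /bad ltNge dP.
have [zw|zw] := eqVneq z w.
  have e8 : 0 < e / 8 by rewrite divr_gt0.
  have /cg/nbhs_normcP[d d0 dP] : nbhs (g w) [set y : C | normc (y - g w) < e / 8].
    by apply/nbhs_normcP; exists (e / 8).
  exists (d / 2); first by rewrite divr_gt0.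
  move=> x y s /andP[s_ge0 sd] zin; rewrite /J -(sq_int_sub_affine (g w) 0 _ _ cg).
  apply: (@le_trans _ _ (8 * (e / 8 * s))).
    apply: sq_int_norm => // [|u uin _].
      exact/continuous_sq_continuous/continuous_sub_affine.
    rewrite mul0r addr0; apply/ltW/dP; rewrite -zw.
    by apply: le_lt_trans (in_sq_normc zin uin) _; rewrite mulrC -ltr_pdivlMr.
  rewrite mulrA [8 * _]mulrC divfK// ler_pM2l//.
  apply: (@le_trans _ _ (weight w x y s)); last by rewrite lerDr sqr_ge0.
  by apply: weight_ge_side; rewrite // -zw.
have [l dz] : exists l, is_derive z 1 g l.
  by exists ('D_1 g z); apply: derivableP; exact: dg.
have e16 : 0 < e / 16 by rewrite divr_gt0.
have [d d0 dP] := (is_derive_normcP _ _ _).1 dz _ e16.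
exists (d / 2); first by rewrite divr_gt0.
move=> x y s /andP[s_ge0 sd] zin.
rewrite /J -(sq_int_sub_affine (g z - l * z) l _ _ cg).
apply: (@le_trans _ _ (8 * (e / 16 * (2 * s) * s))).
  apply: sq_int_norm => // [|u uin _].
    exact/continuous_sq_continuous/continuous_sub_affine.
  have us := in_sq_normc zin uin.
  have -> : g u - (g z - l * z + l * u) = g u - g z - l * (u - z) by ring.
  apply: le_trans (dP u _) _.
    by apply: le_lt_trans us _; rewrite mulrC -ltr_pdivlMr.
  by rewrite ler_pM2l.
have -> : 8 * (e / 16 * (2 * s) * s) = e * s ^+ 2 by field.
by rewrite ler_pM2l// lerDl weight_ge0.
Qed.

(** * Cauchy's formula and higher derivatives *)

(** If [g] were unbounded on the square, then by bisection it would be unbounded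
    near some point. *)
Lemma continuous_bounded_sq (g : C -> C) (x y s : R) : 0 <= s -> continuous g ->
  exists M : R, forall z, in_sq x y s z -> normc (g z) <= M.
Proof.
move=> s0 cg; apply: contrapT => unb.
pose bad a b c := ~ exists M : R, forall z, in_sq a b c z -> normc (g z) <= M.
have step a b c : 0 <= c -> bad a b c ->
    exists a' b', [/\ a' = a \/ a' = a + c / 2, b' = b \/ b' = b + c / 2
      & bad a' b' (c / 2)].
  move=> c0 abc; apply: contrapT => nobad.
  have B a' b' : a' = a \/ a' = a + c / 2 -> b' = b \/ b' = b + c / 2 ->
      exists M : R, forall z, in_sq a' b' (c / 2) z -> normc (g z) <= M.
    by move=> ? ?; apply: contrapT => ?; apply: nobad; exists a', b'.
  have [M1 B1] := B a b (or_introl erefl) (or_introl erefl).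
  have [M2 B2] := B _ b (or_intror erefl) (or_introl erefl).
  have [M3 B3] := B a _ (or_introl erefl) (or_intror erefl).
  have [M4 B4] := B _ _ (or_intror erefl) (or_intror erefl).
  apply: abc; exists (Num.max (Num.max M1 M2) (Num.max M3 M4)).
  move=> z /andP[/andP[h1 h2] /andP[h3 h4]]; rewrite !le_max.
  have [h5|h5] := leP (complex.Re z) (a + c / 2);
    have [h6|h6] := leP (complex.Im z) (b + c / 2).
  - by rewrite B1//; apply/andP; split; apply/andP; split; lra.
  - by rewrite B3 ?orbT//; apply/andP; split; apply/andP; split; lra.
  - by rewrite B2 ?orbT//; apply/andP; split; apply/andP; split; lra.
  - by rewrite B4 ?orbT//; apply/andP; split; apply/andP; split; lra.
have [z [_ zP]] := bisection s0 step unb.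
have : nbhs (g z) [set u : C | normc (u - g z) < 1] by apply/nbhs_normcP; exists 1.
move=> /cg/nbhs_normcP[d d0 dP].
have [|a [b [c [abc /andP[c0 cd] zin _]]]] := zP (d / 2); first by rewrite divr_gt0.
apply: abc; exists (normc (g z) + 1) => u uin.
rewrite -[g u](subrK (g z)) addrC (le_trans (le_normcD _ _))// lerD2l.
apply/ltW/dP; apply: le_lt_trans (in_sq_normc zin uin) _.
by rewrite mulrC -ltr_pdivlMr.
Qed.

Lemma sq_continuous_edge (g : C -> C) (x y s : R) :
  (forall z, sq_edge x y s z -> {for z, continuous g}) ->
  sq_continuous g (x +i* y)%C (s%:C)%C.
Proof.
move=> cg; split => t; have [e1 e2 e3 e4] := sq_edge_segment x y s t.
- by apply: continuous_comp; [exact: continuous_segment|exact: cg].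
- by apply: continuous_comp; [exact: continuous_segment|exact: cg].
- by apply: continuous_comp; [exact: continuous_segment|exact: cg].
- by apply: continuous_comp; [exact: continuous_segment|exact: cg].
Qed.

Lemma eq_sq_int (g h : C -> C) (x y s : R) :
  (forall z, sq_edge x y s z -> g z = h z) ->
  sq_int g (x +i* y)%C (s%:C)%C = sq_int h (x +i* y)%C (s%:C)%C.
Proof.
move=> gh; have E (A q : C) : (forall t, sq_edge x y s (segment A q t)) ->
    seg_int g A q = seg_int h A q.
  by move=> eA; rewrite /seg_int; congr (_ * cint _); apply/funext => t /=; exact: gh.
by rewrite /sq_int !E// => t; case: (sq_edge_segment x y s t).
Qed.

(** Differentiation under the integral sign: [phi] is bounded on the square, so a
    second-order bound on the kernel, uniform along the boundary, gives a
    second-order bound on the integral. *)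
Lemma is_derive_sq_int (phi : C -> C) (k : C -> C -> C) (k' : C -> C)
    (w : C) (x y s B d : R) : 0 < s -> continuous phi -> 0 <= B -> 0 < d ->
  (forall u z, normc (u - w) < d -> sq_edge x y s z -> {for z, continuous (k u)}) ->
  (forall z, sq_edge x y s z -> {for z, continuous k'}) ->
  (forall u z, normc (u - w) < d -> sq_edge x y s z ->
    normc (k u z - k w z - k' z * (u - w)) <= B * normc (u - w) ^+ 2) ->
  is_derive w 1 (fun u => sq_int (fun z => phi z * k u z) (x +i* y)%C (s%:C)%C)
    (sq_int (fun z => phi z * k' z) (x +i* y)%C (s%:C)%C).
Proof.
move=> s0 cphi B0 d0 ck ck' kB; set A := (x +i* y)%C; set q := (s%:C)%C.
have [M phiM] := continuous_bounded_sq x y (ltW s0) cphi.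
have M0 : 0 <= M.
  apply: le_trans (phiM (x +i* y)%C _); first exact: normc_ge0.
  by apply/andP; split; apply/andP; split => /=; lra.
apply/is_derive_normcP => e e0.
pose N := 8 * (M * B * s) + 1.
have N0 : 0 < N by rewrite ltr_wpDl// !mulr_ge0// ltW.
exists (Num.min d (e / N)); first by rewrite lt_min d0 divr_gt0.
move=> u; rewrite lt_min => /andP[ud ue].
have wd : normc (w - w) < d by rewrite subrr normc0.
have cphik v : normc (v - w) < d ->
    sq_continuous (fun z => phi z * k v z) A q.
  move=> vd; apply: sq_continuous_edge => z ze.
  by apply: continuous_at_mul; [exact: cphi|exact: ck].
have cphik' : sq_continuous (fun z => phi z * k' z) A q.
  by apply: sq_continuous_edge => z ze; apply: continuous_at_mul; [exact: cphi|exact: ck'].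
have cN v : normc (v - w) < d -> sq_continuous (fun z => -1 * (phi z * k v z)) A q.
  move=> vd; apply: sq_continuous_edge => z ze.
  apply: continuous_at_mul; first exact: continuous_at_cst.
  by apply: continuous_at_mul; [exact: cphi|exact: ck].
have cN' : sq_continuous (fun z => - (u - w) * (phi z * k' z)) A q.
  apply: sq_continuous_edge => z ze; apply: continuous_at_mul; first exact: continuous_at_cst.
  by apply: continuous_at_mul; [exact: cphi|exact: ck'].
have cD : sq_continuous (fun z => phi z * k u z + -1 * (phi z * k w z)) A q.
  apply: sq_continuous_edge => z ze; apply: continuous_at_add.
    by apply: continuous_at_mul; [exact: cphi|exact: ck].
  apply: continuous_at_mul; first exact: continuous_at_cst.
  by apply: continuous_at_mul; [exact: cphi|exact: ck].
have cE : sq_continuous (fun z => phi z * k u z + -1 * (phi z * k w z)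
    + - (u - w) * (phi z * k' z)) A q.
  apply: sq_continuous_edge => z ze; apply: continuous_at_add.
    apply: continuous_at_add; first by apply: continuous_at_mul; [exact: cphi|exact: ck].
    apply: continuous_at_mul; first exact: continuous_at_cst.
    by apply: continuous_at_mul; [exact: cphi|exact: ck].
  apply: continuous_at_mul; first exact: continuous_at_cst.
  by apply: continuous_at_mul; [exact: cphi|exact: ck'].
have := sq_intD cD cN'; rewrite (sq_intD (cphik _ ud) (cN _ wd)).
rewrite (sq_intZ _ (cphik _ wd)) (sq_intZ _ cphik') mulN1r mulNr.
rewrite [_ * (u - w)]mulrC => <-.
apply: (@le_trans _ _ (8 * (M * (B * normc (u - w) ^+ 2) * s))).
  apply: (sq_int_norm (ltW s0) cE) => z zin ze.
  have -> : phi z * k u z + -1 * (phi z * k w z) + - (u - w) * (phi z * k' z) =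
    phi z * (k u z - k w z - k' z * (u - w)) by ring.
  rewrite normcM ler_pM ?normc_ge0//; first exact: phiM.
  exact: kB.
have -> : 8 * (M * (B * normc (u - w) ^+ 2) * s) =
  8 * (M * B * s) * normc (u - w) * normc (u - w) by ring.
rewrite ler_wpM2r ?normc_ge0//.
apply: (@le_trans _ _ (N * normc (u - w))).
  by rewrite ler_wpM2r ?normc_ge0// lerDl.
by rewrite mulrC -ler_pdivlMr// ltW.
Qed.

(** The square of center [c] and half side [h]; the points at distance less than
    [h / 2] from [c] stay at distance at least [h / 2] from its boundary. *)
Section CauchyFormula.
Variables (c : C) (h : R).
Hypothesis h0 : 0 < h.

Let x := complex.Re c - h.
Let y := complex.Im c - h.
Let s := 2 * h.
Let A : C := (x +i* y)%C.
Let q : C := (s%:C)%C.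
Let b : R := 2 / h.

Let s0 : 0 < s. Proof. by rewrite mulr_gt0. Qed.

Let edge_far z : sq_edge x y s z -> h <= normc (z - c).
Proof.
move=> e; have := normc_Re (z - c); have := normc_Im (z - c).
rewrite /x /y /s in e.
have dRe : complex.Re (z - c) = complex.Re z - complex.Re c by case: (z) (c) => ? ? [].
have dIm : complex.Im (z - c) = complex.Im z - complex.Im c by case: (z) (c) => ? ? [].
rewrite dRe dIm !ler_norml => /andP[i1 i2] /andP[r1 r2].
by case: e => e; lra.
Qed.

Let far u z : normc (u - c) < h / 2 -> sq_edge x y s z -> h / 2 <= normc (z - u).
Proof.
move=> uc /edge_far zc; have := le_normcD (z - u) (u - c).
by rewrite addrA subrK; lra.
Qed.

Let far_neq u z : normc (u - c) < h / 2 -> sq_edge x y s z -> z - u != 0.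
Proof.
move=> uc /(far uc); apply: contraTneq => ->; rewrite normc0 -ltNge.
by rewrite divr_gt0.
Qed.

Let far_inv u z : normc (u - c) < h / 2 -> sq_edge x y s z ->
  normc (z - u)^-1 <= b.
Proof.
move=> uc /(far uc) zu; rewrite normcV /b -invf_div lef_pV2// posrE ?divr_gt0//.
by apply: lt_le_trans zu; rewrite divr_gt0.
Qed.

Let cont_kern u z : normc (u - c) < h / 2 -> sq_edge x y s z ->
  {for z, continuous (fun z : C => (z - u)^-1)}.
Proof.
move=> uc ze; apply: (@continuous_at_inv C (fun z => z - u)); first exact: (far_neq uc ze).
by apply: (@continuous_at_add C id); [exact: cvg_id|exact: continuous_at_cst].
Qed.

Let cauchy (phi : C -> C) (n : nat) (w : C) :=
  sq_int (fun z => phi z * (z - w)^-1 ^+ n) A q.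

Let cont_kernX n u z : normc (u - c) < h / 2 -> sq_edge x y s z ->
  {for z, continuous (fun z : C => (z - u)^-1 ^+ n)}.
Proof.
move=> uc ze; elim: n => [|n IH].
  by rewrite (_ : (fun z => _) = cst 1); [exact: continuous_at_cst|apply/funext => ?; rewrite expr0].
rewrite (_ : (fun z => _) = fun z : C => (z - u)^-1 * (z - u)^-1 ^+ n).
  exact: (continuous_at_mul (cont_kern uc ze) IH).
by apply/funext => ?; rewrite exprS.
Qed.

Let near_c w u : normc (w - c) < h / 2 -> normc (u - w) < h / 2 - normc (w - c) ->
  normc (u - c) < h / 2.
Proof.
move=> wc uw; have := le_normcD (u - w) (w - c).
by rewrite addrA subrK; lra.
Qed.

Let cauchy1_derive (phi : C -> C) w : continuous phi -> normc (w - c) < h / 2 ->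
  is_derive w 1 (cauchy phi 1) (cauchy phi 2 w).
Proof.
move=> cphi wc.
have b0 : 0 <= b by rewrite divr_ge0// ltW.
apply: (@is_derive_sq_int phi (fun u z => (z - u)^-1 ^+ 1)
  (fun z => (z - w)^-1 ^+ 2) w x y s (b ^+ 3) (h / 2 - normc (w - c))).
- exact: s0.
- exact: cphi.
- exact: exprn_ge0.
- by rewrite subr_gt0.
- by move=> u z /(near_c wc) uc ze; exact: cont_kernX.
- by move=> z ze; exact: cont_kernX.
move=> u z /(near_c wc) uc ze; rewrite !expr1.
have zu := far_neq uc ze; have zw := far_neq wc ze.
have -> : (z - u)^-1 - (z - w)^-1 - (z - w)^-1 ^+ 2 * (u - w) =
    (z - w)^-1 * (z - w)^-1 * (z - u)^-1 * ((u - w) * (u - w)).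
  by field; rewrite zu zw.
rewrite !normcM -expr2 ler_wpM2r ?sqr_ge0// [b ^+ 3](_ : _ = b * b * b); last by ring.
by rewrite !ler_pM ?mulr_ge0 ?normc_ge0// far_inv.
Qed.

Let cauchy2_derivable (phi : C -> C) w : continuous phi -> normc (w - c) < h / 2 ->
  derivable (cauchy phi 2) w 1.
Proof.
move=> cphi wc.
have b0 : 0 <= b by rewrite divr_ge0// ltW.
suff : is_derive w 1 (cauchy phi 2)
    (sq_int (fun z => phi z * (2 * (z - w)^-1 ^+ 3)) A q) by case.
apply: (@is_derive_sq_int phi (fun u z => (z - u)^-1 ^+ 2)
  (fun z => 2 * (z - w)^-1 ^+ 3) w x y s (b ^+ 3 * (b + 2 * b)) (h / 2 - normc (w - c))).
- exact: s0.
- exact: cphi.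
- by rewrite mulr_ge0 ?exprn_ge0//; lra.
- by rewrite subr_gt0.
- by move=> u z /(near_c wc) uc ze; exact: cont_kernX.
- by move=> z ze; apply: continuous_at_mul; [exact: continuous_at_cst|exact: cont_kernX].
move=> u z /(near_c wc) uc ze.
have zu := far_neq uc ze; have zw := far_neq wc ze.
have -> : (z - u)^-1 ^+ 2 - (z - w)^-1 ^+ 2 - 2 * (z - w)^-1 ^+ 3 * (u - w) =
    (z - w)^-1 * (z - w)^-1 * (z - u)^-1 * ((z - u)^-1 + 2 * (z - w)^-1)
      * ((u - w) * (u - w)).
  by field; rewrite zu zw.
have n2 : normc (2 : C) = 2.
  by rewrite -(rmorph_nat (real_complex R)) normc_real.
rewrite normcM [normc ((u - w) * _)]normcM -expr2 ler_wpM2r ?sqr_ge0// normcM.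
rewrite ler_pM ?normc_ge0//.
  rewrite !normcM [b ^+ 3](_ : _ = b * b * b); last by ring.
  by rewrite !ler_pM ?mulr_ge0 ?normc_ge0// far_inv.
apply: le_trans (le_normcD _ _) _; rewrite normcM n2.
by apply: lerD; rewrite ?ler_pM2l// far_inv.
Qed.

(** The kernel integral at the center is eight times the average of
    1 / (2 t - 1 - i), whose imaginary part 1 / ((2 t - 1) ^ 2 + 1) is positive. *)
Let cauchy_center : cauchy (fun=> 1) 1 c != 0.
Proof.
pose k (t : R) : C := ((2 * t - 1) +i* -1)%C.
have k0 t : k t != 0 by rewrite eq_complex /= oppr_eq0 oner_eq0 andbF.
have ck : continuous (fun t => (k t)^-1).
  move=> t; apply: cvgV; first exact: k0.
  apply: (@continuous_complex R (fun t => 2 * t - 1) (fun=> -1) t).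
    by apply: cvgB; [apply: cvgM; [exact: cvg_cst|exact: cvg_id]|exact: cvg_cst].
  exact: cvg_cst.
have side (A' q' e : C) : e != 0 -> q' = 2 * e -> (forall t, segment A' q' t - c = e * k t) ->
    seg_int (fun z => 1 * (z - c)^-1 ^+ 1) A' q' = 2 * cint (fun t => (k t)^-1).
  move=> e0 q'e Ae; rewrite /seg_int.
  rewrite (_ : _ \o _ = fun t => e^-1 * (k t)^-1); last first.
    by apply/funext => t; rewrite /= mul1r expr1 Ae invfM.
  by rewrite (cintZ _ ck) q'e mulrA mulfK.
have hC : (h%:C)%C != 0 :> C by rewrite (fmorph_eq0 (real_complex R)) gt_eqF.
have iC : i1 != 0 :> C by rewrite eq_complex /= oner_eq0 andbF.
have -> : cauchy (fun=> 1) 1 c = 8 * cint (fun t => (k t)^-1).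
  rewrite /cauchy /sq_int.
  rewrite (side A q (h%:C)%C)//; last 2 first.
  - by rewrite /q /s rmorphM /= rmorph_nat.
  - move=> t; rewrite /segment /A /q /x /y /s /k; case: (c) => c1 c2.
    by apply/eqP; rewrite eq_complex /=; apply/andP; split; apply/eqP; ring.
  rewrite (side (A + q) (i1 * q) (i1 * (h%:C)%C)); last 3 first.
  - by rewrite mulf_neq0.
  - by rewrite /q /s rmorphM /= rmorph_nat; ring.
  - move=> t; rewrite /segment /A /q /x /y /s /k; case: (c) => c1 c2.
    by apply/eqP; rewrite eq_complex /=; apply/andP; split; apply/eqP; ring.
  rewrite (side (A + q + i1 * q) (- q) (- (h%:C)%C)); last 3 first.
  - by rewrite oppr_eq0.
  - by rewrite /q /s rmorphM /= rmorph_nat; ring.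
  - move=> t; rewrite /segment /A /q /x /y /s /k; case: (c) => c1 c2.
    by apply/eqP; rewrite eq_complex /=; apply/andP; split; apply/eqP; ring.
  rewrite (side (A + i1 * q) (- (i1 * q)) (- (i1 * (h%:C)%C))); last 3 first.
  - by rewrite oppr_eq0 mulf_neq0.
  - by rewrite /q /s rmorphM /= rmorph_nat; ring.
  - move=> t; rewrite /segment /A /q /x /y /s /k; case: (c) => c1 c2.
    by apply/eqP; rewrite eq_complex /=; apply/andP; split; apply/eqP; ring.
  ring.
rewrite mulf_neq0 ?pnatr_eq0//.
suff : complex.Im (cint (fun t => (k t)^-1)) != 0 by apply: contraNneq => ->.
rewrite /=; have [t _ ->] := int01_mean (continuous_Im_comp ck).
rewrite -[complex.Im _]/(- (-1 / ((2 * t - 1) ^+ 2 + (-1) ^+ 2))).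
by rewrite mulN1r opprK invr_eq0 gt_eqF// ltr_wpDl ?sqr_ge0// sqrrN expr1n.
Qed.

Let core_in_sq w : normc (w - c) < h / 2 -> in_sq x y s w.
Proof.
have dRe : complex.Re (w - c) = complex.Re w - complex.Re c by case: (w) (c) => ? ? [].
have dIm : complex.Im (w - c) = complex.Im w - complex.Im c by case: (w) (c) => ? ? [].
have := normc_Re (w - c); have := normc_Im (w - c).
rewrite dRe dIm !ler_norml => /andP[i1 i2] /andP[r1 r2] wc.
by rewrite /in_sq /x /y /s; apply/andP; split; apply/andP; split; lra.
Qed.

(** The difference quotient of [f] at [w] is continuous, and differentiable
    except at [w], hence its boundary integral vanishes. *)
Let cauchy_formula (f : C -> C) (w : C) : continuous f ->
  (forall z, in_sq x y s z -> derivable f z 1) -> normc (w - c) < h / 2 ->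
  cauchy f 1 w = f w * cauchy (fun=> 1) 1 w.
Proof.
move=> cf df wc; pose l := 'D_1 f w.
have dfw : is_derive w 1 f l by apply/derivableP/df/core_in_sq.
pose g z := if z == w then l else (f z - f w) * (z - w)^-1.
have gE z : z != w -> \forall u \near z, (f u - f w) * (u - w)^-1 = g u.
  by move=> /nbhs_neq; apply: filterS => u uw; rewrite /g (negbTE uw).
have dg z : in_sq x y s z -> z != w -> derivable g z 1.
  move=> zin zw; apply: (near_eq_derivable (gE z zw)).
  apply: derivableM.
    by apply: derivableB; [exact: df|exact: derivable_cst].
  apply: derivableV; first by rewrite subr_eq0.
  by apply: derivableB; [exact: derivable_id|exact: derivable_cst].
have cg : continuous g.
  move=> z; have [->|zw] := eqVneq z w; last first.
    have cq : {for z, continuous (fun u : C => (f u - f w) * (u - w)^-1)}.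
      apply: continuous_at_mul; first by apply: continuous_at_add; [exact: cf|exact: continuous_at_cst].
      apply: (@continuous_at_inv C (fun u => u - w)); first by rewrite subr_eq0.
      by apply: (@continuous_at_add C id); [exact: cvg_id|exact: continuous_at_cst].
    move=> V; rewrite {1}/g (negbTE zw) => /cq cV.
    by apply: filterS2 (gE z zw) cV => u /= <-.
  move=> V /nbhs_normcP[e e0 eV].
  have e20 : 0 < e / 2 by rewrite divr_gt0.
  have [d d0 dP] := (is_derive_normcP _ _ _).1 dfw _ e20.
  apply/nbhs_normcP; exists d => // u ud; apply: eV; rewrite /g eqxx.
  have [_|uw] := eqVneq u w; first by rewrite subrr normc0.
  have uw0 : u - w != 0 by rewrite subr_eq0.
  have nuw : 0 < normc (u - w).
    rewrite lt_neqAle normc_ge0 andbT eq_sym; apply: contra uw0 => /eqP/eq0_normc.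
    by move=> ->.
  have -> : (f u - f w) * (u - w)^-1 - l = (f u - f w - l * (u - w)) * (u - w)^-1.
    by field.
  rewrite normcM normcV ltr_pdivrMr//; apply: le_lt_trans (dP u ud) _.
  by rewrite ltr_pM2r// ltr_pdivrMr// mulr_natr mulr2n ltrDl.
have g0 : sq_int g A q = 0 by exact: (goursat (ltW s0) cg dg).
have ck1 (phi : C -> C) : continuous phi ->
    sq_continuous (fun z => phi z * (z - w)^-1 ^+ 1) A q.
  move=> cphi; apply: sq_continuous_edge => z ze.
  by apply: continuous_at_mul; [exact: cphi|exact: cont_kernX].
have c1 : continuous ((fun=> 1) : C -> C) by move=> z; exact: continuous_at_cst.
have ck1N : sq_continuous (fun z => - f w * (1 * (z - w)^-1 ^+ 1)) A q.
  apply: sq_continuous_edge => z ze; apply: continuous_at_mul; first exact: continuous_at_cst.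
  by apply: continuous_at_mul; [exact: continuous_at_cst|exact: cont_kernX].
apply/eqP; rewrite -subr_eq0 -mulNr; apply/eqP.
rewrite /cauchy -(sq_intZ _ (ck1 _ c1)) -(sq_intD (ck1 _ cf) ck1N) -[RHS]g0.
apply: eq_sq_int => z ze; rewrite /g ifN; first by rewrite expr1; ring.
by rewrite -subr_eq0 (far_neq wc ze).
Qed.

Lemma derivable_derive1_center (f : C -> C) : continuous f ->
  (forall z, in_sq x y s z -> derivable f z 1) -> derivable (derive1 f) c 1.
Proof.
move=> cf df; have c1 : continuous ((fun=> 1) : C -> C) by move=> z; exact: continuous_at_cst.
pose F := cauchy f 1; pose G := cauchy (fun=> 1) 1.
pose F' := cauchy f 2; pose G' := cauchy (fun=> 1) 2.
have h20 : 0 < h / 2 by rewrite divr_gt0.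
have core : \forall w \near c, normc (w - c) < h / 2.
  by apply/nbhs_normcP; exists (h / 2).
have cc : normc (c - c) < h / 2 by rewrite subrr normc0.
have dF w : normc (w - c) < h / 2 -> is_derive w 1 F (F' w) by exact: cauchy1_derive.
have dG w : normc (w - c) < h / 2 -> is_derive w 1 G (G' w) by exact: cauchy1_derive.
apply: (@derivable_derive1_quotient C F G F' G' f c).
- by apply: filterS core => w; exact: dF.
- by apply: filterS core => w; exact: dG.
- exact: cauchy2_derivable.
- exact: cauchy2_derivable.
- exact: cauchy_center.
- by apply: filterS core => w wc; exact: cauchy_formula.
Qed.

End CauchyFormula.

(** Precomposition with the retraction of the plane onto a small square around
    [c] makes [f] continuous everywhere without changing it near [c]. *)
Lemma derivable_derive1 (f : C -> C) (c : C) :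
  (\forall z \near c, derivable f z 1) -> derivable (derive1 f) c 1.
Proof.
move=> /nbhs_normcP[r r0 df].
pose h := r / 5; have h0 : 0 < h by rewrite divr_gt0.
pose clamp (m t : R) := Num.max (m - 2 * h) (Num.min (m + 2 * h) t).
have cclamp m : continuous (clamp m).
  move=> t; apply: (@continuous_max _ _ (fun=> m - 2 * h) (fun t => Num.min (m + 2 * h) t)).
    exact: cvg_cst.
  apply: (@continuous_min _ _ (fun=> m + 2 * h) id); first exact: cvg_cst.
  exact: cvg_id.
have clampP m t : m - 2 * h <= clamp m t <= m + 2 * h.
  by rewrite le_max lexx/= ge_max ge_min lexx andbT; lra.
have clamp_id m t : m - 2 * h <= t <= m + 2 * h -> clamp m t = t.
  by move=> /andP[m1 m2]; rewrite /clamp (min_idPr m2) (max_idPr m1).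
pose cl (z : C) : C := (clamp (complex.Re c) (complex.Re z) +i*
                        clamp (complex.Im c) (complex.Im z))%C.
have ccl : continuous cl.
  move=> z; apply: (@continuous_complex C (fun z => clamp (complex.Re c) (complex.Re z))
      (fun z => clamp (complex.Im c) (complex.Im z)) z).
    by apply: continuous_comp; [exact: continuous_Re|exact: cclamp].
  by apply: continuous_comp; [exact: continuous_Im|exact: cclamp].
have dRe u : complex.Re (u - c) = complex.Re u - complex.Re c by case: (u) (c) => ? ? [].
have dIm u : complex.Im (u - c) = complex.Im u - complex.Im c by case: (u) (c) => ? ? [].
have cl_near z : normc (cl z - c) < r.
  apply: le_lt_trans (normc_le _) _; rewrite dRe dIm /=.
  have := clampP (complex.Re c) (complex.Re z); have := clampP (complex.Im c) (complex.Im z).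
  move=> /andP[? ?] /andP[? ?]; apply: (@le_lt_trans _ _ (2 * h + 2 * h)).
    by apply: lerD; rewrite ler_norml; apply/andP; split; lra.
  by rewrite /h in h0 *; lra.
have cfcl : continuous (f \o cl).
  move=> z; apply: continuous_comp; first exact: ccl.
  exact/differentiable_continuous/derivable1_diffP/df/cl_near.
have eq_cl z u : in_sq (complex.Re c - h) (complex.Im c - h) (2 * h) z ->
    normc (u - z) < h -> f (cl u) = f u.
  move=> /andP[/andP[? ?] /andP[? ?]] uz.
  have := le_lt_trans (normc_Re (u - z)) uz; have := le_lt_trans (normc_Im (u - z)) uz.
  have -> : complex.Re (u - z) = complex.Re u - complex.Re z by case: (u) (z) => ? ? [].
  have -> : complex.Im (u - z) = complex.Im u - complex.Im z by case: (u) (z) => ? ? [].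
  rewrite !ltr_norml => /andP[? ?] /andP[? ?]; rewrite /cl !clamp_id; last 2 first.
  - by apply/andP; split; lra.
  - by apply/andP; split; lra.
  by case: (u).
have near_cl z : in_sq (complex.Re c - h) (complex.Im c - h) (2 * h) z ->
    \forall u \near z, f u = (f \o cl) u.
  by move=> zin; apply/nbhs_normcP; exists h => // u uz; rewrite /= (eq_cl z u).
have cin : in_sq (complex.Re c - h) (complex.Im c - h) (2 * h) c.
  by apply/andP; split; apply/andP; split; lra.
have : derivable (derive1 (f \o cl)) c 1.
  apply: (derivable_derive1_center h0 cfcl) => z zin.
  apply: (near_eq_derivable (near_cl z zin)); apply: df.
  have cl_z : cl z = z.
    move: zin => /andP[/andP[? ?] /andP[? ?]]; rewrite /cl !clamp_id; last 2 first.
    - by apply/andP; split; lra.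
    - by apply/andP; split; lra.
    by case: (z).
  by rewrite -cl_z.
apply: near_eq_derivable; apply: filterS (near_join (near_cl c cin)) => w fw.
exact/esym/near_eq_derive1.
Qed.

End ComplexPlane.

(** * Algebraic dependence *)

Lemma row_dependence (K : fieldType) (I J : finType) (a : I -> J -> K) :
  (#|J| < #|I|)%N ->
  exists u : I -> K, (exists i, u i != 0) /\ forall j, \sum_i u i * a i j = 0.
Proof.
move=> JI; pose A := \matrix_(i < #|I|, j < #|J|) a (enum_val i) (enum_val j).
have /rowV0Pn[v /sub_kermxP vA v0] : kermx A != 0.
  rewrite -mxrank_eq0 mxrank_ker subn_eq0 -ltnNge.
  exact: leq_ltn_trans (rank_leq_col A) JI.
exists (fun i => v 0 (enum_rank i)); split.
  by case/rV0Pn: v0 => i vi; exists (enum_val i); rewrite enum_valK.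
move=> j; have /matrixP/(_ 0 (enum_rank j)) := vA; rewrite !mxE => vAj.
rewrite -[RHS]vAj [RHS](reindex enum_rank) /=; last first.
  by exists enum_val => ? _; [exact: enum_rankK|exact: enum_valK].
by apply: eq_bigr => i _; rewrite mxE !enum_rankK.
Qed.

Section MultivariateDegree.
Variables (K : fieldType) (N : nat).
Implicit Types p q : mpoly N K.
Local Notation msize p := (mmeasure (@mdeg N) p).

Lemma msize_mul_le p q (a b : nat) : (msize p <= a.+1)%N -> (msize q <= b.+1)%N ->
  (msize (p * q) <= (a + b).+1)%N.
Proof.
move=> pa qb; have [->|p0] := eqVneq p 0; first by rewrite mul0r mmeasure0.
have [->|q0] := eqVneq q 0; first by rewrite mulr0 mmeasure0.
rewrite (msizeM p0 q0); have := leq_add pa qb.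
by case: (msize p + msize q)%N => // k; rewrite addSn addnS ltnS.
Qed.

Lemma msize_exp_le p (a k : nat) : (msize p <= a.+1)%N ->
  (msize (p ^+ k) <= (k * a).+1)%N.
Proof.
move=> pa; elim: k => [|k IH]; first by rewrite expr0 msize1.
by rewrite exprS mulSn; exact: msize_mul_le.
Qed.

Lemma msize_prod_le (I : finType) (F : I -> mpoly N K) (a : nat) :
  (forall i, (msize (F i) <= a.+1)%N) -> (msize (\prod_i F i) <= (#|I| * a).+1)%N.
Proof.
move=> Fa; rewrite -sum_nat_const.
apply: (big_ind2 (fun (p : mpoly N K) k => msize p <= k.+1)%N) => //.
- by rewrite msize1.
- by move=> p a' q b'; exact: msize_mul_le.
Qed.

End MultivariateDegree.

Definition exponents (n b : nat) (e : {ffun 'I_n -> 'I_b}) : multinom n :=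
  Multinom [tuple (e i : nat) | i < n].

Lemma exponentsE n b (e : {ffun 'I_n -> 'I_b}) i : exponents e i = e i.
Proof. by rewrite multinomE tnth_mktuple. Qed.

(** More than [N] polynomials in [N] variables are algebraically dependent: there
    are [d ^ n] monomials with exponents below [d] in the [n] polynomials, and
    the coefficients of their values lie in a box of side linear in [d], hence of
    size O(d ^ N). *)
Lemma algebraic_dependence (K : fieldType) (N n : nat) (g : 'I_n -> mpoly N K) :
  (N < n)%N ->
  exists P : mpoly n K, P != 0 /\
    forall x : 'I_N -> K, meval (fun i => meval x (g i)) P = 0.
Proof.
move=> Nn.
pose c := \max_i mmeasure (@mdeg N) (g i).
pose e := (n * c).+1; pose d := (e ^ N).+1; pose B := (d * e)%N.
pose I := {ffun 'I_n -> 'I_d}; pose J := {ffun 'I_N -> 'I_B}.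
have JI : (#|J| < #|I|)%N.
  rewrite !card_ffun !card_ord expnMn.
  apply: (@leq_trans (d ^ N.+1)); last by rewrite leq_exp2l// ltnS expn_gt0.
  by rewrite expnSr ltn_pmul2l ?expn_gt0.
pose mon (nu : I) := \prod_i g i ^+ nu i.
have smon nu : (mmeasure (@mdeg N) (mon nu) <= B)%N.
  have H i : (mmeasure (@mdeg N) (g i ^+ nu i) <= (d.-1 * c).+1)%N.
    have gc : (mmeasure (@mdeg N) (g i) <= c.+1)%N.
      by apply: leqW; exact: (leq_bigmax (F := fun i => mmeasure (@mdeg N) (g i)) i).
    apply: leq_trans (msize_exp_le _ gc) _.
    by rewrite ltnS leq_mul2r -ltnS ltn_ord orbT.
  apply: leq_trans (msize_prod_le H) _.
  rewrite card_ord /B /e mulnS mulnCA.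
  have : (d.-1 * (n * c) <= d * (n * c))%N by rewrite leq_mul2r leq_pred orbT.
  by rewrite /d; lia.
have [u [[nu0 unu0] uA]] :=
  @row_dependence K I J (fun nu mu => mcoeff (exponents mu) (mon nu)) JI.
exists (\sum_nu u nu *: mpolyX K (exponents nu)); split.
  apply/eqP => /(congr1 (mcoeff (exponents nu0))).
  rewrite mcoeff0 raddf_sum /= (bigD1 nu0)//= mcoeffZ mcoeffX eqxx mulr1.
  rewrite big1 ?addr0 => [/eqP|nu nunu0]; first by rewrite (negbTE unu0).
  rewrite mcoeffZ mcoeffX; case: eqP => [E|]; last by rewrite mulr0.
  case/eqP: nunu0; apply/ffunP => i; apply/val_inj.
  by have /mnmP/(_ i) := E; rewrite !exponentsE.
move=> x.
have -> : meval (fun i => meval x (g i)) (\sum_nu u nu *: mpolyX K (exponents nu))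
    = meval x (\sum_nu u nu *: mon nu).
  rewrite !raddf_sum /=; apply: eq_bigr => nu _; rewrite !mevalZ mevalX; congr (_ * _).
  by rewrite rmorph_prod /=; apply: eq_bigr => i _; rewrite exponentsE rmorphXn.
suff -> : \sum_nu u nu *: mon nu = 0 by rewrite meval0.
apply/mpolyP => m; rewrite mcoeff0 raddf_sum /=.
under eq_bigr do rewrite mcoeffZ.
have [/forallP mB|] := boolP [forall i, m i < B]%N.
  have := uA [ffun i => Ordinal (mB i)]; rewrite (_ : exponents _ = m)//.
  by apply/mnmP => i; rewrite exponentsE ffunE.
case/forallPn => i; rewrite -leqNgt => Bm.
apply: big1 => nu _; rewrite memN_msupp_eq0 ?mulr0//.
apply: mmeasure_mnm_ge; apply: leq_trans (smon nu) _; apply: leq_trans Bm _.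
by rewrite [leqRHS](mdegE m) (bigD1 i)//= leq_addr.
Qed.

(** * Finitely generated differential algebras of functions *)

Section DifferentialAlgebras.
Variable K : numFieldType.
Implicit Types (W U V : set K) (f g h x : K -> K) (xs ys : seq (K -> K)).

Inductive generated W xs : (K -> K) -> Prop :=
| gen_cst c : generated W xs (fun=> c)
| gen_mem x : x \in xs -> generated W xs x
| gen_add f g : generated W xs f -> generated W xs g ->
    generated W xs (fun z => f z + g z)
| gen_mul f g : generated W xs f -> generated W xs g ->
    generated W xs (fun z => f z * g z)
| gen_ext f g : (forall z, W z -> f z = g z) -> generated W xs f ->
    generated W xs g.

Definition diff_closed W xs := forall x, x \in xs ->
  exists y, generated W xs y /\ forall z, W z -> is_derive z 1 x (y z).

(** Stability under differentiation is required of an algebra that is finitely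
    generated as an algebra: this is what bounds the number of algebraically
    independent functions among the derivatives of [h].  The inverse of a function
    without zeros may be one of the generators ([tame_inv]). *)
Definition tame W h := exists xs, diff_closed W xs /\ generated W xs h.

Lemma gen_sub W V xs ys h : W `<=` V -> {subset xs <= ys} ->
  generated V xs h -> generated W ys h.
Proof.
move=> WV sub; elim=> [c|x xin|f g _ IHf _ IHg|f g _ IHf _ IHg|f g fg _ IH].
- exact: gen_cst.
- exact/gen_mem/sub.
- exact: gen_add.
- exact: gen_mul.
- by apply: gen_ext IH => z /WV; exact: fg.
Qed.

Lemma gen_sum W xs (I : Type) (r : seq I) (F : I -> K -> K) :
  (forall i, generated W xs (F i)) -> generated W xs (fun z => \sum_(i <- r) F i z).
Proof.
move=> gF; elim: r => [|i r IH].
  by apply: gen_ext (gen_cst _ _ 0) => z _; rewrite big_nil.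
by apply: gen_ext (gen_add (gF i) IH) => z _; rewrite big_cons.
Qed.

Lemma gen_prod W xs (I : Type) (r : seq I) (F : I -> K -> K) :
  (forall i, generated W xs (F i)) -> generated W xs (fun z => \prod_(i <- r) F i z).
Proof.
move=> gF; elim: r => [|i r IH].
  by apply: gen_ext (gen_cst _ _ 1) => z _; rewrite big_nil.
by apply: gen_ext (gen_mul (gF i) IH) => z _; rewrite big_cons.
Qed.

Lemma gen_exp W xs h k : generated W xs h -> generated W xs (fun z => h z ^+ k).
Proof.
move=> gh; elim: k => [|k IH]; first exact: gen_ext (gen_cst _ _ 1).
by apply: gen_ext (gen_mul gh IH) => z _; rewrite exprS.
Qed.

Lemma gen_opp W xs h : generated W xs h -> generated W xs (fun z => - h z).
Proof.
by move=> gh; apply: gen_ext (gen_mul (gen_cst _ _ (-1)) gh) => z _; rewrite mulN1r.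
Qed.

Lemma gen_derive W xs h : open W -> diff_closed W xs -> generated W xs h ->
  exists y, generated W xs y /\ forall z, W z -> is_derive z 1 h (y z).
Proof.
move=> oW cl; elim=> [c|x xin|f g gf [f' [gf' df]] gg [g' [gg' dg]]
    |f g gf [f' [gf' df]] gg [g' [gg' dg]]|f g fg gf [f' [gf' df]]].
- by exists (fun=> 0); split; [exact: gen_cst|move=> z _; exact: is_derive_cst].
- exact: cl.
- exists (fun z => f' z + g' z); split; first exact: gen_add.
  by move=> z Wz; apply: is_deriveD; [exact: df|exact: dg].
- exists (fun z => f z * g' z + g z * f' z); split.
    by apply: gen_add; exact: gen_mul.
  by move=> z Wz; apply: is_deriveM; [exact: df|exact: dg].
- exists f'; split=> // z Wz; apply: near_eq_is_derive (df z Wz).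
  by apply: filterS (open_nbhs_nbhs (conj oW Wz)) => w; exact: fg.
Qed.

Lemma gen_mpoly W xs h : generated W xs h -> exists p : mpoly (size xs) K,
  forall z, W z -> h z = meval (fun i => tnth (in_tuple xs) i z) p.
Proof.
elim=> [c|x xin|f g _ [p hp] _ [q hq]|f g _ [p hp] _ [q hq]|f g fg _ [p hp]].
- by exists (mpolyC _ c) => z _; rewrite mevalC.
- have xi : (index x xs < size xs)%N by rewrite index_mem.
  exists (mpolyX K (mnm1 (Ordinal xi))) => z _.
  by rewrite mevalXU (tnth_nth x) /= nth_index.
- by exists (p + q) => z Wz; rewrite mevalD -hp// -hq.
- by exists (p * q) => z Wz; rewrite mevalM -hp// -hq.
- by exists p => z Wz; rewrite -fg// hp.
Qed.

Lemma tame_sub W V h : W `<=` V -> tame V h -> tame W h.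
Proof.
move=> WV [xs [cl gh]]; exists xs; split; last exact: gen_sub gh.
move=> x /cl[y [gy dy]]; exists y; split; first exact: gen_sub gy.
by move=> z /WV; exact: dy.
Qed.

Lemma diff_closed_cat W xs ys :
  diff_closed W xs -> diff_closed W ys -> diff_closed W (xs ++ ys).
Proof.
move=> cx cy x; rewrite mem_cat => /orP[/cx|/cy] [y [gy dy]]; exists y; split=> //.
  by apply: gen_sub gy => // t; rewrite mem_cat => ->.
by apply: gen_sub gy => // t; rewrite mem_cat => ->; rewrite orbT.
Qed.

Lemma tame_ext W f g : (forall z, W z -> f z = g z) -> tame W f -> tame W g.
Proof. by move=> fg [xs [cl gf]]; exists xs; split=> //; exact: gen_ext gf. Qed.

Lemma tame_cst W c : tame W (fun=> c).
Proof. by exists [::]; split=> //; exact: gen_cst. Qed.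

Lemma tame_op W f g (op : (K -> K) -> (K -> K) -> K -> K) :
  (forall xs, generated W xs f -> generated W xs g -> generated W xs (op f g)) ->
  tame W f -> tame W g -> tame W (op f g).
Proof.
move=> gop [xs [cx gf]] [ys [cy gg]]; exists (xs ++ ys); split.
  exact: diff_closed_cat.
apply: gop.
  by apply: gen_sub gf => // t; rewrite mem_cat => ->.
by apply: gen_sub gg => // t; rewrite mem_cat => ->; rewrite orbT.
Qed.

Lemma tame_add W f g : tame W f -> tame W g -> tame W (fun z => f z + g z).
Proof.
by apply: (tame_op (op := fun f g z => f z + g z)) => xs; exact: gen_add.
Qed.

Lemma tame_mul W f g : tame W f -> tame W g -> tame W (fun z => f z * g z).
Proof.
by apply: (tame_op (op := fun f g z => f z * g z)) => xs; exact: gen_mul.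
Qed.

Lemma tame_sum W (I : eqType) (r : seq I) (F : I -> K -> K) :
  (forall i, i \in r -> tame W (F i)) -> tame W (fun z => \sum_(i <- r) F i z).
Proof.
elim: r => [|i r IH] tF.
  by apply: tame_ext (tame_cst W 0) => z _; rewrite big_nil.
have tr : tame W (fun z => \sum_(j <- r) F j z).
  by apply: IH => j jr; apply: tF; rewrite inE jr orbT.
apply: tame_ext (tame_add (tF i (mem_head _ _)) tr) => z _; by rewrite big_cons.
Qed.

Lemma tame_prod W (I : Type) (r : seq I) (F : I -> K -> K) :
  (forall i, tame W (F i)) -> tame W (fun z => \prod_(i <- r) F i z).
Proof.
move=> tF; elim: r => [|i r IH].
  by apply: tame_ext (tame_cst W 1) => z _; rewrite big_nil.
by apply: tame_ext (tame_mul (tF i) IH) => z _; rewrite big_cons.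
Qed.

Lemma tame_exp W h k : tame W h -> tame W (fun z => h z ^+ k).
Proof.
move=> th; elim: k => [|k IH]; first exact: tame_ext (tame_cst W 1).
by apply: tame_ext (tame_mul th IH) => z _; rewrite exprS.
Qed.

Lemma tame_id W : tame W id.
Proof.
exists [:: id]; split; last by apply: gen_mem; rewrite mem_head.
move=> x; rewrite inE => /eqP ->; exists (fun=> 1); split; first exact: gen_cst.
by move=> z _; exact: is_derive_id.
Qed.

Lemma tame_horner W (p : {poly K}) : tame W (fun z => p.[z]).
Proof.
elim/poly_ind: p => [|p c IH].
  by apply: tame_ext (tame_cst W 0) => z _; rewrite horner0.
apply: tame_ext (tame_add (tame_mul IH (tame_id W)) (tame_cst W c)) => z _.
by rewrite !hornerE.
Qed.

Lemma is_derive_inv h z (l : K) : h z != 0 -> is_derive z 1 h l ->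
  is_derive z 1 (fun w => (h w)^-1) (- ((h z)^-1 * (h z)^-1) * l).
Proof.
move=> hz [dh <-]; split; first exact: derivableV.
by rewrite deriveV// expr2 invfM.
Qed.

(** The inverse is adjoined to the generators: (1 / h)' = - (1 / h) ^ 2 * h'. *)
Lemma tame_inv W h : open W -> (forall z, W z -> h z != 0) -> tame W h ->
  tame W (fun z => (h z)^-1).
Proof.
move=> oW h0 [xs [cl gh]]; pose s z := (h z)^-1.
have [h' [gh' dh]] := gen_derive oW cl gh.
have sub : {subset xs <= s :: xs} by move=> t; rewrite inE orbC => ->.
have gs : generated W (s :: xs) s by apply: gen_mem; rewrite mem_head.
exists (s :: xs); split=> // x; rewrite inE => /predU1P[->|/cl[y [gy dy]]].
  exists (fun z => - (s z * s z) * h' z); split.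
    by apply: gen_mul; [apply/gen_opp/gen_mul|exact: gen_sub gh'].
  by move=> z Wz; apply: is_derive_inv; [exact: h0|exact: dh].
by exists y; split=> //; exact: gen_sub gy.
Qed.

Lemma tame_derive W h : open W -> tame W h ->
  (forall z, W z -> derivable h z 1) /\ tame W (derive1 h).
Proof.
move=> oW [xs [cl gh]]; have [h' [gh' dh]] := gen_derive oW cl gh; split.
  by move=> z /dh[].
exists xs; split=> //; apply: gen_ext gh' => z /dh[_ dhz].
by rewrite derive1E dhz.
Qed.

Lemma tame_derive1n W h i : open W -> tame W h -> tame W (derive1n i h).
Proof. by move=> oW th; elim: i => // i IH; exact: (tame_derive oW IH).2. Qed.

(** A relation exists for every large enough order [k], and not just for one, so
    that relations found on different sets can be multiplied. *)
Definition diff_algebraic_on W h := exists k0 : nat, forall k, (k0 <= k)%N ->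
  exists P : mpoly k.+1 K, P != 0 /\
    forall z, W z -> meval (fun i => derive1n i h z) P = 0.

(** All derivatives of [h] are polynomials in the finitely many generators, and
    more polynomials than variables are algebraically dependent. *)
Lemma tame_diff_algebraic_on W h : open W -> tame W h -> diff_algebraic_on W h.
Proof.
move=> oW [xs [cl gh]]; exists (size xs) => k sk.
have gen_i i : generated W xs (derive1n i h).
  elim: i => // i IH; have [h' [gh' dh]] := gen_derive oW cl IH.
  by apply: gen_ext gh' => z /dh[_ dhz]; rewrite derive1nS derive1E dhz.
have /choice[p pE] := fun i => gen_mpoly (gen_i i).
have [P [P0 PE]] := @algebraic_dependence K (size xs) k.+1 (fun i => p i) sk.
exists P; split=> // z Wz; rewrite -[RHS](PE (fun i => tnth (in_tuple xs) i z)).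
by apply: meval_eq => i; rewrite pE.
Qed.

End DifferentialAlgebras.

(** * Separants and finite coverings *)

Section Separants.
Variable K : numFieldType.
Implicit Types (W U V : set K) (f g h : K -> K) (xs ys : seq (K -> K)).

Lemma is_derive_meval n (x : 'I_n -> K -> K) (e : 'I_n -> K) (z : K) (p : mpoly n K) :
  (forall i, is_derive z 1 (x i) (e i)) ->
  is_derive z 1 (fun w => meval (fun i => x i w) p)
    (\sum_i meval (fun i => x i z) (mderiv i p) * e i).
Proof.
move=> dx.
pose D (q : mpoly n K) := is_derive z 1 (fun w => meval (fun i => x i w) q)
    (\sum_i meval (fun i => x i z) (mderiv i q) * e i).
have DC c : D (mpolyC n c).
  rewrite /D big1 => [|i _]; last by rewrite mderivC meval0 mul0r.
  by rewrite (_ : (fun w => _) = cst c); [exact: is_derive_cst|apply/funext => w; rewrite mevalC].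
have DD p1 p2 : D p1 -> D p2 -> D (p1 + p2).
  move=> d1 d2; have := is_deriveD d1 d2; rewrite /D.
  rewrite -big_split /= (_ : (fun w => meval _ (p1 + p2)) =
    (fun w => meval (fun i => x i w) p1) + (fun w => meval (fun i => x i w) p2)).
    congr (is_derive _ _ _ _); apply: eq_bigr => i _.
    by rewrite mderivD mevalD mulrDl.
  by apply/funext => w; rewrite mevalD.
have DM p1 p2 : D p1 -> D p2 -> D (p1 * p2).
  move=> d1 d2; have := is_deriveM d1 d2; rewrite /D.
  rewrite -[_ *: \sum_i _]/(_ * _) -[X in _ + X]/(_ * _).
  rewrite !big_distrr -big_split /= (_ : (fun w => meval _ (p1 * p2)) =
    (fun w => meval (fun i => x i w) p1) * (fun w => meval (fun i => x i w) p2)).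
    congr (is_derive _ _ _ _); apply: eq_bigr => i _.
    by rewrite mderivM mevalD !mevalM; ring.
  by apply/funext => w; rewrite mevalM.
have DX i : D (mpolyX K (mnm1 i)).
  rewrite /D (bigD1 i)//= big1 ?addr0 => [|j ji]; last first.
    by rewrite mderivX mnm1E eq_sym (negbTE ji) scale0r meval0 mul0r.
  rewrite mderivX mnm1E eqxx scale1r (_ : mnm_sub _ _ = @mnm0 n); last first.
    by apply/mnmP => j; rewrite mnmBE subnn mnm0E.
  rewrite mpolyX0 meval1 mul1r (_ : (fun w => _) = x i)//.
  by apply/funext => w; rewrite mevalXU.
rewrite -/(D p) [p]mpolyE.
apply: (big_ind D) => [|p1 p2|m _]; [exact: (DC 0)|exact: DD|].
rewrite -mul_mpolyC; apply: (DM _ _ (DC _)).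
rewrite mpolyXE_id; apply: (big_ind D) => [|p1 p2|i _]; [exact: (DC 1)|exact: DM|].
by elim: (m i) => [|k IH]; [exact: (DC 1)|rewrite exprS; exact: DM (DX i) IH].
Qed.

Lemma mderiv_eq0_supp n (p : mpoly n K) (i : 'I_n) (m : multinom n) :
  mderiv i p = 0 -> m \in msupp p -> m i = 0%N.
Proof.
move=> dp; rewrite mcoeff_msupp; apply: contraNeq => mi.
have := mcoeff_deriv i (mnm_sub m (mnm1 i)) p.
rewrite dp mcoeff0 submK; last by rewrite lep1mP.
by move=> /esym/eqP; rewrite mulrn_eq0.
Qed.

Lemma mderiv_eq0_const n (p : mpoly n K) :
  (forall i, mderiv i p = 0) -> p = mpolyC n (mcoeff (@mnm0 n) p).
Proof.
move=> dp; apply: msize1_polyC; apply/bigmax_leqP_seq => m mp _.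
rewrite ltnS leqn0; apply/eqP; rewrite [LHS](mdegE m); apply: big1 => i _.
exact: mderiv_eq0_supp (dp i) mp.
Qed.

Lemma msize_mderiv n (p : mpoly n K) (i : 'I_n) : mderiv i p != 0 ->
  (mmeasure (@mdeg n) (mderiv i p) < mmeasure (@mdeg n) p)%N.
Proof.
move=> dp; rewrite (mpolySpred _ dp) -ltnS.
have := mlead_deg dp => <- /=.
have : mnm_add (mlead (mderiv i p)) (mnm1 i) \in msupp p.
  have := mlead_supp dp; rewrite !mcoeff_msupp mcoeff_deriv.
  by apply: contraNneq => ->; rewrite mul0rn.
by move=> /(@mmeasure_mnm_lt _ _ (@mdeg n)); rewrite /= mdegD mdeg1 addn1.
Qed.

(** Only the functions whose variables occur in [p], that is those with a nonzero
    partial derivative, have to be among the generators. *)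
Lemma gen_meval n W xs (x : 'I_n -> K -> K) (p : mpoly n K) :
  (forall i, mderiv i p != 0 -> x i \in xs) ->
  generated W xs (fun z => meval (fun i => x i z) p).
Proof.
move=> xin; pose y i := if mderiv i p != 0 then x i else fun=> 1.
have gy i : generated W xs (y i).
  by rewrite /y; case: ifP => [/xin xi|_]; [exact: gen_mem|exact: gen_cst].
have : generated W xs (fun z => \sum_(m <- msupp p) mcoeff m p * \prod_i y i z ^+ m i).
  apply: gen_sum => m; apply: gen_mul; first exact: gen_cst.
  by apply: gen_prod => i; exact: gen_exp.
apply: gen_ext => z _; rewrite mevalE !big_seq; apply: eq_bigr => m mp.
congr (_ * _); apply: eq_bigr => i _; rewrite /y; case: eqP => //= dp.
by rewrite (mderiv_eq0_supp dp mp) !expr0.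
Qed.

(** [U] is, up to a nowhere dense set, a finite union of open sets with property
    [Q].  The pieces are the leaves of a binary tree, so that a covering is
    refined by grafting, and a property is carried from the pieces to [U] one
    binary union at a time. *)
Inductive covered (Q : set K -> Prop) : set K -> Prop :=
| cover_leaf U : open U -> Q U -> covered Q U
| cover_node U W V : open U -> W `<=` U -> V `<=` U ->
    (forall z A, U z -> nbhs z A -> exists w, A w /\ (W w \/ V w)) ->
    covered Q W -> covered Q V -> covered Q U.

Lemma covered_refine (Q Q' : set K -> Prop) U : covered Q U ->
  (forall W, open W -> W `<=` U -> Q W -> covered Q' W) -> covered Q' U.
Proof.
elim=> {}U.
- by move=> oU QU H; exact: H.
- move=> W V oU WU VU dns _ IHW _ IHV H; apply: (cover_node oU WU VU dns).
    by apply: IHW => A oA AW; apply: H => //; exact: subset_trans AW WU.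
  by apply: IHV => A oA AV; apply: H => //; exact: subset_trans AV VU.
Qed.

Lemma covered_weaken (Q Q' : set K -> Prop) U : covered Q U ->
  (forall W, open W -> W `<=` U -> Q W -> Q' W) -> covered Q' U.
Proof.
by move=> cQ H; apply: covered_refine cQ _ => W oW WU /(H _ oW WU); exact: cover_leaf.
Qed.

Lemma covered_forall (n : nat) (Q : 'I_n -> set K -> Prop) U : open U ->
  (forall i W V, W `<=` V -> Q i V -> Q i W) ->
  (forall i W, open W -> W `<=` U -> covered (Q i) W) ->
  covered (fun W => forall i, Q i W) U.
Proof.
move=> oU mon cov.
suff H k : (k <= n)%N -> covered (fun W => forall i : 'I_n, (i < k)%N -> Q i W) U.
  by apply: covered_weaken (H n (leqnn n)) _ => W _ _ QW i; exact: QW.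
elim: k => [_|k IH kn]; first exact: cover_leaf.
apply: covered_refine (IH (ltnW kn)) _ => W oW WU QW.
apply: covered_weaken (cov (Ordinal kn) W oW WU) _ => V oV VW QV i.
rewrite ltnS leq_eqVlt => /predU1P[ik|/QW]; last exact: mon.
by rewrite (_ : i = Ordinal kn)//; exact: val_inj.
Qed.

(** The product of the relations found on two pieces vanishes on both, hence on a
    dense subset of their union, hence everywhere by continuity. *)
Lemma covered_diff_algebraic_on U a : covered (fun W => diff_algebraic_on W a) U ->
  (forall i z, U z -> derivable (derive1n i a) z 1) -> diff_algebraic_on U a.
Proof.
elim=> {}U // W V oU WU VU dns _ IHW _ IHV da.
have [|kW HW] := IHW _; first by move=> i z /WU; exact: da.
have [|kV HV] := IHV _; first by move=> i z /VU; exact: da.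
exists (maxn kW kV) => k; rewrite geq_max => /andP[/HW[P [P0 PW]] /HV[Q [Q0 QV]]].
exists (P * Q); split; first by rewrite mulf_neq0.
move=> z Uz; apply: contrapT => /eqP nz.
have dPQ : derivable (fun w => meval (fun i : 'I_k.+1 => derive1n i a w) (P * Q)) z 1.
  have di (i : 'I_k.+1) : is_derive z 1 (derive1n i a) ('D_1 (derive1n i a) z).
    exact/derivableP/da.
  by have [] := is_derive_meval (P * Q) di.
have cPQ := differentiable_continuous ((derivable1_diffP _ _).1 dPQ).
have [w [/eqP nw WVw]] := dns z _ Uz (continuous_at_neq0 cPQ nz); apply: nw.
by rewrite mevalM; case: WVw => [/PW|/QV] ->; rewrite ?mul0r ?mulr0.
Qed.

(** In the applications [x 0] is an affine function and [x 1], [x 2], ... are the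
    successive derivatives of one function up to constant factors.  Let [j] be
    the largest index of a variable of [p].  Where the separant [S], the partial
    derivative of [p] in that variable, does not vanish, differentiation of the
    relation expresses the derivative of [x j] through [x 0], ..., [x j] and
    1 / S, so that these generate a differential algebra; where [S] vanishes
    identically, it is a relation of smaller degree.  The case [j = 0] is
    excluded because the derivative of [x 0] does not vanish. *)
Lemma covered_tame n (x e : nat -> K -> K) U : open U ->
  (forall i z, U z -> is_derive z 1 (x i) (e i z)) ->
  (forall i, generated U [seq x j | j <- iota 0 i.+2] (e i)) ->
  (forall z, U z -> e 0 z != 0) ->
  (exists2 p : mpoly n K, p != 0 &
    forall z, U z -> meval (fun i : 'I_n => x i z) p = 0) ->
  covered (fun W => tame W (x 1)) U.
Proof.
move=> oU dx ge e0 [p p0 pU].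
have [k] := ubnP (mmeasure (@mdeg n) p).
elim: k => // k IH in p p0 U oU dx ge e0 pU *; rewrite ltnS => sp.
have [/forallP dp0|] := boolP [forall i, mderiv i p == 0].
  have pc := mderiv_eq0_const (fun i => eqP (dp0 i)).
  have U0 z : U z -> False.
    move=> /pU; rewrite pc mevalC => /eqP; apply/negP.
    by apply: contra p0 => /eqP c0; rewrite pc c0 mpolyC0.
  by apply: cover_leaf => //; apply: tame_ext (tame_cst U 0) => z /U0.
case/forallPn => i0 i0P.
have [j dj jmax] := @arg_maxnP _ i0 (fun i => mderiv i p != 0) (fun i => i : nat) i0P.
have jm (i : 'I_n) : mderiv i p != 0 -> (i <= j)%N by exact: jmax.
pose S := mderiv j p; pose s z := meval (fun i : 'I_n => x i z) S.
have cs z : U z -> {for z, continuous s}.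
  move=> Uz; have [ds _] := is_derive_meval S (fun i : 'I_n => dx i z Uz).
  exact: differentiable_continuous ((derivable1_diffP _ _).1 ds).
have sum0 z : U z ->
    \sum_(i < n) meval (fun i : 'I_n => x i z) (mderiv i p) * e i z = 0.
  move=> Uz; have [_ <-] := is_derive_meval p (fun i : 'I_n => dx i z Uz).
  rewrite (near_eq_derive (g := cst 0)) ?derive_cst//.
  by apply: filterS (open_nbhs_nbhs (conj oU Uz)) => w; exact: pU.
pose W := U `&` [set z | s z != 0]; pose V := interior (U `&` [set z | s z = 0]).
have oW : open W.
  rewrite openE => z [Uz sz]; apply: filterI; first exact: open_nbhs_nbhs.
  exact: continuous_at_neq0 (cs z Uz) sz.
have VU : V `<=` U by move=> z /interior_subset[].
have WU : W `<=` U by move=> z [].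
apply: (cover_node oU WU VU).
- move=> z A Uz zA; have [[w [Aw Ww]]|noW] := pselect (exists w, A w /\ W w).
    by exists w; split=> //; left.
  exists z; split; [exact: nbhs_singleton|right].
  apply: filterS2 zA (open_nbhs_nbhs (conj oU Uz)) => w Aw Uw; split=> //.
  by apply: contrapT => /eqP sw; apply: noW; exists w.
- apply: cover_leaf => //; have [j0|j0] := posnP j.
    (* The relation involves only x 0, so its derivative is s * x 0'. *)
    have W0 z : W z -> False.
      move=> [Uz /negP]; apply.
      have := sum0 z Uz; rewrite (bigD1 j)//= big1 ?addr0 => [/eqP|i ij].
        by rewrite mulf_eq0 j0 (negbTE (e0 z Uz)) orbF.
      have [->|di] := eqVneq (mderiv i p) 0; first by rewrite meval0 mul0r.
      by case/eqP: ij; apply: val_inj; apply/eqP; have := jm _ di; rewrite /= j0 leqn0.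
    by apply: tame_ext (tame_cst W 0) => z /W0.
  (* x 1 is one of x 0, ..., x j, and adjoining 1 / s closes the algebra. *)
  pose r z := (s z)^-1; pose xs := r :: [seq x i | i <- iota 0 j.+1].
  have xin (i : nat) : (i <= j)%N -> x i \in xs.
    by move=> ij; rewrite inE map_f ?orbT// mem_iota.
  have gx i : (i <= j)%N -> generated W xs (x i) by move=> /xin; exact: gen_mem.
  have gr : generated W xs r by apply: gen_mem; rewrite mem_head.
  have ge_lt i : (i < j)%N -> generated W xs (e i).
    move=> ij; apply: gen_sub (ge i) => // t /mapP[l]; rewrite mem_iota add0n => /andP[_ l2] ->.
    by apply: xin; move: l2 ij; lia.
  have gp (q : mpoly n K) : (forall i : 'I_n, mderiv i q != 0 -> (i <= j)%N) ->
      generated W xs (fun z => meval (fun i : 'I_n => x i z) q).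
    by move=> qj; apply: (@gen_meval n W xs (fun i => x i)) => i /qj; exact: xin.
  have dbound (l i : 'I_n) : mderiv i (mderiv l p) != 0 -> (i <= j)%N.
    rewrite mderiv_comm => d; apply: jm; apply: contraNneq d => ->.
    by rewrite mderiv0.
  have gl (l : 'I_n) : generated W xs (fun z => meval (fun i : 'I_n => x i z) (mderiv l p)).
    by apply: gp => i; exact: dbound.
  (* The relation differentiated, solved for the derivative of x j. *)
  have gej : generated W xs (e j).
    have : generated W xs (fun z => - (\sum_(i < n) if (i < j)%N
        then meval (fun i : 'I_n => x i z) (mderiv i p) * e i z else 0) * r z).
      apply: gen_mul => //; apply: gen_opp; apply: gen_sum => i; case: ltnP => ij.
        by apply: gen_mul; [exact: gl|exact: ge_lt].
      exact: gen_cst.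
    apply: gen_ext => z [Uz sz].
    have := sum0 z Uz; rewrite (bigD1 j)//= => /eqP; rewrite addr_eq0 => /eqP E.
    rewrite -big_mkcond /= (_ : \sum_(i < n | (i < j)%N) _ =
      \sum_(i < n | i != j) meval (fun i : 'I_n => x i z) (mderiv i p) * e i z).
      by rewrite -E -/S -/(s z) /r mulrAC mulfV// mul1r.
    rewrite [RHS](bigID (fun i : 'I_n => (i < j)%N)) /= [X in _ + X]big1 ?addr0.
      apply: eq_bigl => i; case: ltnP => ij; last by rewrite andbF.
      by rewrite andbT; apply/esym; apply: contraTneq ij => ->; rewrite ltnn.
    move=> i /andP[ij]; rewrite -leqNgt => ji.
    have [->|di] := eqVneq (mderiv i p) 0; first by rewrite meval0 mul0r.
    by case/eqP: ij; apply: val_inj; apply/eqP; rewrite /= eqn_leq ji andbT; exact: jm.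
  have gei (i : nat) : (i <= j)%N -> generated W xs (e i).
    by rewrite leq_eqVlt => /predU1P[->//|]; exact: ge_lt.
  exists xs; split; last exact: gx.
  move=> t; rewrite inE => /predU1P[->|/mapP[l]]; last first.
    rewrite mem_iota add0n ltnS => /andP[_ lj] ->; exists (e l); split; first exact: gei.
    by move=> z [Uz _]; exact: dx.
  exists (fun z => - (r z * r z) * \sum_(i < n)
    (if (i <= j)%N then meval (fun i : 'I_n => x i z) (mderiv i S) * e i z else 0)); split.
    apply: gen_mul; first by apply: gen_opp; exact: gen_mul.
    apply: gen_sum => i; case: leqP => ij; last exact: gen_cst.
    apply: gen_mul; last exact: gei.
    apply: gp => l; rewrite /S => d; apply: jm; apply: contraNneq d => dl.
    by rewrite (mderiv_comm i l) (mderiv_comm j l) dl !mderiv0.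
  move=> z [Uz sz]; apply: is_derive_inv => //.
  have := is_derive_meval S (fun i : 'I_n => dx i z Uz); congr (is_derive _ _ _ _).
  apply: eq_bigr => i _; case: leqP => // ji.
  rewrite (_ : mderiv i S = 0) ?meval0 ?mul0r//; apply: contraTeq ji => d.
  by rewrite -leqNgt; exact: dbound d.
- apply: (IH S dj) => //.
  + exact: open_interior.
  + by move=> i z /VU; exact: dx.
  + by move=> i; exact: gen_sub (ge i).
  + by move=> z /VU; exact: e0.
  + by move=> z /interior_subset[].
  + exact: leq_trans (msize_mderiv dj) sp.
Qed.

End Separants.

(** * Rational functions as coefficients *)

Section RationalCoefficients.
Variable K : numFieldType.
Implicit Types (r : ratfun K) (p : {poly K}) (z : K).

Definition numer r : {poly K} := (frac (repr r)).1.
Definition denom r : {poly K} := (frac (repr r)).2.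

Lemma denom_neq0 r : denom r != 0. Proof. exact: denom_ratioP. Qed.

Lemma tofracE p : FracField.tofrac p = \pi_({fraction {poly K}})%qT (Ratio p 1).
Proof. by rewrite /FracField.tofrac -lock. Qed.

Lemma numer_eq0 r : numer r = 0 -> r = 0.
Proof.
move=> n0; rewrite -[r]reprK -(tofrac0 {poly K}) tofracE.
apply/eqP; rewrite FracField.equivf_def numer_Ratio ?oner_neq0// -/(numer r) n0.
by rewrite mul0r mulr0.
Qed.

Lemma ratfun_eval_tofracC (c z : K) :
  (denom (FracField.tofrac c%:P)).[z] != 0 ->
  ratfun_eval (FracField.tofrac c%:P) z = c.
Proof.
rewrite /ratfun_eval -/(numer _) -/(denom _) => dz.
have := FracField.equivf_l (Ratio c%:P 1); rewrite -tofracE.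
rewrite !numden_Ratio ?oner_neq0// mulr1 -/(numer _) -/(denom _) => ->.
by rewrite hornerM hornerC mulrAC mulfV// mul1r.
Qed.

Lemma horner_neq0_near p z0 : p != 0 -> \forall w \near z0^', p.[w] != 0.
Proof.
have [k] := ubnP (size p); elim: k => // k IH in p *; rewrite ltnS => sp p0.
have [pz0|pz0] := eqVneq p.[z0] 0; last first.
  apply: cvg_within; apply: continuous_at_neq0 pz0.
  have [dp _] := tame_derive openT (tame_horner setT p).
  exact/differentiable_continuous/derivable1_diffP/dp.
have /factor_theorem[q pq] : root p z0 by rewrite /root pz0.
have q0 : q != 0 by apply: contraNneq p0 => q0; rewrite pq q0 mul0r.
have sq : (size q < k)%N.
  by move: sp; rewrite pq size_mul ?polyXsubC_eq0// size_XsubC addn2.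
apply: filterS2 (IH q sq q0) (nbhs_dnbhs_neq z0) => w qw wz0.
by rewrite pq hornerM !hornerE mulf_neq0// subr_eq0.
Qed.

Definition denoms_neq0 n (p : mpoly n (ratfun K)) z :=
  forall m, m \in msupp p -> (denom (mcoeff m p)).[z] != 0.

Lemma denoms_neq0_near n (p : mpoly n (ratfun K)) z0 :
  \forall w \near z0^', denoms_neq0 p w.
Proof.
rewrite /denoms_neq0; elim: (msupp p) => [|m s IH].
  by apply: filterE => w m; rewrite in_nil.
apply: filterS2 IH (horner_neq0_near z0 (denom_neq0 (mcoeff m p))) => w IHw mw m'.
by rewrite inE => /predU1P[->|/IHw].
Qed.

Lemma mpoly_funE n (p : mpoly n (ratfun K)) (h : 'I_n -> K -> K) z :
  mpoly_fun p h z = \sum_(m <- msupp p)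
    ratfun_eval (mcoeff m p) z * \prod_(i < n) h i z ^+ m i.
Proof. by []. Qed.

Definition mcons n (j : nat) (m : multinom n) : multinom n.+1 :=
  Multinom [tuple of j :: m].

Lemma mcons0 n j (m : multinom n) : mcons j m ord0 = j.
Proof. by rewrite multinomE. Qed.

Lemma mconsS n j (m : multinom n) i : mcons j m (lift ord0 i) = m i.
Proof. by rewrite multinomE tnthS mnm_tnth. Qed.

Lemma mcons_inj n j j' (m m' : multinom n) :
  mcons j m = mcons j' m' -> j = j' /\ m = m'.
Proof.
move=> /mnmP E; split; first by have := E ord0; rewrite !mcons0.
by apply/mnmP => i; have := E (lift ord0 i); rewrite !mconsS.
Qed.

(** A relation over K(z) becomes a relation over K by clearing denominators and
    counting z among the unknown functions. *)
Lemma clear_denominators n (p : mpoly n (ratfun K)) : p != 0 ->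
  exists2 q : mpoly n.+1 K, q != 0 &
    forall (h : 'I_n -> K -> K) (y : 'I_n.+1 -> K) z, denoms_neq0 p z ->
      y ord0 = z -> (forall i, y (lift ord0 i) = h i z) ->
      mpoly_fun p h z = 0 -> meval y q = 0.
Proof.
move=> p0.
pose N m := numer (mcoeff m p) *
  \prod_(m' <- msupp p | m' != m) denom (mcoeff m' p).
have N0 m : m \in msupp p -> N m != 0.
  rewrite mcoeff_msupp => pm; rewrite mulf_neq0//.
    by apply: contra pm => /eqP/numer_eq0 ->.
  by rewrite prodf_seq_neq0; apply/allP => m' _; rewrite denom_neq0 implybT.
pose q := \sum_(m <- msupp p) \sum_(j < size (N m)) (N m)`_j *: mpolyX K (mcons j m).
exists q.
  pose m0 := mlead p; have m0p : m0 \in msupp p by exact: mlead_supp.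
  apply/eqP => /(congr1 (mcoeff (mcons (size (N m0)).-1 m0))).
  rewrite mcoeff0 raddf_sum /= (bigD1_seq m0) ?msupp_uniq//=.
  have sN : ((size (N m0)).-1 < size (N m0))%N.
    by rewrite prednK ?size_poly_gt0// N0.
  rewrite raddf_sum /= (bigD1 (Ordinal sN))//= mcoeffZ mcoeffX eqxx mulr1.
  rewrite big1 => [|j jN]; last first.
    rewrite mcoeffZ mcoeffX; case: eqP => [/mcons_inj[E _]|]; last by rewrite mulr0.
    by case/eqP: jN; exact: val_inj.
  rewrite big1 => [|m mm0]; last first.
    rewrite raddf_sum /= big1// => j _; rewrite mcoeffZ mcoeffX.
    case: eqP => [/mcons_inj[_ E]|]; last by rewrite mulr0.
    by rewrite E eqxx in mm0.
  by rewrite !addr0 => /eqP; rewrite -lead_coefE lead_coef_eq0 (negbTE (N0 _ m0p)).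
move=> h y z dz y0 yS ph.
pose D := \prod_(m <- msupp p) (denom (mcoeff m p)).[z].
suff -> : meval y q = D * mpoly_fun p h z by rewrite ph mulr0.
rewrite mpoly_funE big_distrr /= raddf_sum /= !big_seq; apply: eq_bigr => m mp.
have -> : D * (ratfun_eval (mcoeff m p) z * \prod_(i < n) h i z ^+ m i) =
    (N m).[z] * \prod_(i < n) h i z ^+ m i.
  rewrite mulrA; congr (_ * _); rewrite /D (bigD1_seq m) ?msupp_uniq//=.
  rewrite /N hornerM horner_prod /ratfun_eval -/(numer _) -/(denom _).
  by rewrite mulrAC mulrCA mulfV ?mulr1 1?mulrC//; exact: dz.
rewrite horner_coef big_distrl raddf_sum /=; apply: eq_bigr => j _.
rewrite mevalZ mevalX big_ord_recl mcons0 y0 mulrA; congr (_ * _).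
by apply: eq_bigr => i _; rewrite mconsS yS.
Qed.

Lemma diff_algebraic_of_constant (h : K -> K) k (P : mpoly k.+1 K) : P != 0 ->
  mero_eq (fun z => meval (fun i => derive1n i h z) P) (fun=> 0) -> diff_algebraic h.
Proof.
move=> P0 Ph; pose f : {rmorphism K -> ratfun K} := (@FracField.tofrac {poly K}) \o polyC.
have fI : injective f by move=> c d /eqP; rewrite /= tofrac_eq => /eqP/polyC_inj.
exists k, (map_mpoly f P); split.
  apply: contra P0 => /eqP E; apply/eqP/mpolyP => m; apply: fI.
  by rewrite -mcoeff_map_mpoly E !mcoeff0 rmorph0.
move=> z0; apply: filterS2 (Ph z0) (denoms_neq0_near (map_mpoly f P) z0) => w Pw dw.
apply: etrans Pw; rewrite mpoly_funE mevalE.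
rewrite -(perm_big _ (msupp_map_mpoly P fI)) /= !big_seq; apply: eq_bigr => m mP.
rewrite mcoeff_map_mpoly; congr (_ * _); apply: ratfun_eval_tofracC.
by have := dw m mP; rewrite mcoeff_map_mpoly.
Qed.

End RationalCoefficients.

(** * Meromorphic functions *)

Section MeromorphicFunctions.
Variable K : numFieldType.
Implicit Types (f g h : K -> K) (P Q : K -> Prop) (z w : K).

(** A condition that holds near every point, that point excepted, also holds on an
    open set that meets all punctured neighbourhoods. *)
Lemma near_punctured_join P z0 : (\forall w \near z0^', P w) ->
  \forall w \near z0^', \forall u \near w, P u.
Proof.
move=> /near_join PP; apply: filterS PP => w Pw wz0.
by apply: filterS2 Pw (nbhs_neq wz0) => u Pu; exact: Pu.
Qed.

Lemma near_punctured_affine P (alpha beta z0 : K) : alpha != 0 ->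
  (\forall u \near (alpha * z0 + beta)^', P u) ->
  \forall w \near z0^', P (alpha * w + beta).
Proof.
move=> a0 Pu.
have caff : {for z0, continuous (fun w => alpha * w + beta)}.
  rewrite (_ : (fun w => _) = fun w => beta + alpha * w).
    exact: continuous_affine.
  by apply/funext => w; rewrite addrC.
have : \forall w \near z0, alpha * w + beta != alpha * z0 + beta -> P (alpha * w + beta).
  exact: (caff _ Pu).
apply: filterS => w Pw wz0; apply: Pw.
by apply: contra wz0 => /eqP/addIr/(mulfI a0) ->.
Qed.

Lemma meromorphic_derivable_near f z0 : meromorphic f ->
  \forall w \near z0^', derivable f w 1.
Proof.
move=> /(_ z0)[hf|[n [g [hg _ fg]]]]; first exact: cvg_within.
apply: filterS3 (near_punctured_join fg) (nbhs_dnbhs_neq z0) (cvg_within _ hg).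
move=> w fgw wz0 dg.
have dp : derivable (fun u => (u - z0) ^+ n.+1) w 1.
  have [dp _] := tame_derive openT (tame_horner setT (('X - z0%:P) ^+ n.+1)).
  rewrite (_ : (fun u => _) = fun u => (('X - z0%:P) ^+ n.+1).[u]); first exact: dp.
  by apply/funext => u; rewrite !hornerE.
have dV : derivable (fun u => ((u - z0) ^+ n.+1)^-1) w 1.
  by apply: derivableV dp; rewrite expf_neq0// subr_eq0.
have fgw' : \forall u \near w, g u * ((u - z0) ^+ n.+1)^-1 = f u.
  by apply: filterS fgw => u ->.
exact: near_eq_derivable fgw' (derivableM dg dV).
Qed.

(** The one fact of complex analysis on which the algebraic argument rests.  It
    holds over the complex numbers by [derivable_derive1], but not over the reals,
    and is therefore a hypothesis on [K] in what follows. *)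
Definition derivable_regular := forall (f : K -> K) (c : K),
  (\forall z \near c, derivable f z 1) -> derivable (derive1 f) c 1.

Lemma derivable_derive1n f U i : derivable_regular -> open U ->
  (forall z, U z -> derivable f z 1) -> forall z, U z -> derivable (derive1n i f) z 1.
Proof.
move=> reg oU df; elim: i => [//|i IH] z Uz; apply: reg.
by apply: filterS (open_nbhs_nbhs (conj oU Uz)) => w; exact: IH.
Qed.

Definition jet (b : K -> K) (alpha beta : K) (i : nat) (w : K) : K :=
  if i is i'.+1 then derive1n i' b (alpha * w + beta) else alpha * w + beta.

(** The jet of [b] composed with an affine map again satisfies the chain of
    differential relations required by [covered_tame], with a factor [alpha], and
    the polynomial relation itself is the same one for all affine maps. *)
Lemma covered_tame_affine_op n (b : K -> K) (q : mpoly n K) (G W : set K)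
    (alpha beta : K) : derivable_regular -> alpha != 0 -> open G ->
  (forall z, G z -> derivable b z 1) -> q != 0 ->
  (forall z, G z -> meval (fun i : 'I_n => jet b 1 0 i z) q = 0) ->
  open W -> (forall w, W w -> G (alpha * w + beta)) ->
  covered (fun V => tame V (affine_op alpha beta b)) W.
Proof.
move=> reg a0 oG db q0 qG oW WG.
pose e i w := if i is i'.+1 then alpha * jet b alpha beta i'.+2 w else alpha.
rewrite -[affine_op _ _ _]/(jet b alpha beta 1).
apply: (@covered_tame K n (jet b alpha beta) e W) => //.
- move=> i w Ww; case: i => [|i] /=.
    exact: is_derive_affine.
  apply: is_derive_comp_affine; split; last by rewrite -derive1E -derive1nS.
  exact: derivable_derive1n reg oG db _ (WG w Ww).
- case=> [|i]; first exact: gen_cst.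
  apply: gen_mul; first exact: gen_cst.
  by apply: gen_mem; apply: (map_f (jet b alpha beta)); rewrite mem_iota; lia.
- exists q => // w Ww; rewrite -[RHS](qG _ (WG w Ww)); apply: meval_eq => i.
  by rewrite /jet; case: (i : nat) => [|i'] /=; rewrite mul1r addr0.
Qed.

Lemma tame_mpoly_fun W n (p : mpoly n (ratfun K)) (h : 'I_n -> K -> K) :
  open W -> (forall z, W z -> denoms_neq0 p z) -> (forall i, tame W (h i)) ->
  tame W (mpoly_fun p h).
Proof.
move=> oW dW th.
suff : tame W (fun z => \sum_(m <- msupp p)
    ratfun_eval (mcoeff m p) z * \prod_(i < n) h i z ^+ m i).
  by apply: tame_ext => z _; rewrite mpoly_funE.
apply: tame_sum => m mp; apply: tame_mul; last first.
  by apply: tame_prod => i; exact: tame_exp.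
apply: tame_mul; first exact: tame_horner.
apply: tame_inv => //; last exact: tame_horner.
by move=> z /dW; exact.
Qed.

(** [G] and [U] below are open sets that meet every punctured neighbourhood: on
    [G] the function [b] is holomorphic and satisfies its differential equation,
    and on [U] moreover [a] is holomorphic and the functional equation holds.
    For [alpha i = 0] the function [affine_op (alpha i) (beta i) b] is constant,
    hence tame. *)
Lemma diff_algebraic_eq_args (m n : nat) (f : mpoly (m.+1 + n) (ratfun K))
    (a b : K -> K) (alpha beta : 'I_m -> K) : derivable_regular ->
  meromorphic a -> meromorphic b ->
  mero_eq (mpoly_fun f (eq_args alpha beta b)) a ->
  diff_algebraic b -> diff_algebraic a.
Proof.
move=> reg amero bmero fa [k [p [p0 pb]]].
pose jb : 'I_k.+1 -> K -> K := fun i => derive1n i b.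
have [q q0 qE] := clear_denominators p0.
pose G := interior [set z | derivable b z 1 /\
  meval (fun i : 'I_k.+2 => jet b 1 0 i z) q = 0].
have oG : open G by exact: open_interior.
have Gnear z0 : \forall w \near z0^', G w.
  apply: near_punctured_join.
  apply: filterS3 (meromorphic_derivable_near z0 bmero) (pb z0) (denoms_neq0_near p z0).
  move=> w dw pw dn; split=> //; apply: (qE jb _ w dn) => //.
    by rewrite /jet /= mul1r addr0.
  by move=> i; rewrite /jet lift0 /= mul1r addr0.
pose c (i : 'I_m.+1) := if unlift ord0 i is Some i' then affine_op (alpha i') (beta i') b else b.
pose U := interior [set w | [/\ derivable a w 1, denoms_neq0 f w,
  mpoly_fun f (eq_args alpha beta b) w = a w, G w &
  forall i, alpha i != 0 -> G (alpha i * w + beta i)]].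
have oU : open U by exact: open_interior.
have Unear z0 : \forall w \near z0^', U w.
  apply: near_punctured_join.
  have Gi : \forall w \near z0^', forall i, alpha i != 0 -> G (alpha i * w + beta i).
    apply: filter_forall => i; have [->|ai] := eqVneq (alpha i) 0.
      exact: filterE.
    have := @near_punctured_affine G (alpha i) (beta i) z0 ai (Gnear _).
    exact: filterS.
  apply: filterS3 (filterI (fa z0) Gi) (filterI (Gnear z0) (denoms_neq0_near f z0))
    (meromorphic_derivable_near z0 amero) => w [fw Giw] [Gw dn] dw.
  by split.
have UP w : U w -> [/\ derivable a w 1, denoms_neq0 f w,
  mpoly_fun f (eq_args alpha beta b) w = a w, G w &
  forall i, alpha i != 0 -> G (alpha i * w + beta i)] by exact: interior_subset.
have Gb z : G z -> derivable b z 1 by move=> /interior_subset[].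
have Gq z : G z -> meval (fun i : 'I_k.+2 => jet b 1 0 i z) q = 0.
  by move=> /interior_subset[].
have cov i W : open W -> W `<=` U -> covered (fun V => tame V (c i)) W.
  move=> oW WU; rewrite /c; case: unliftP => [i' _|_].
    have [a0|a0] := eqVneq (alpha i') 0.
      apply: cover_leaf => //; apply: tame_ext (tame_cst W (b (beta i'))) => w _.
      by rewrite /affine_op a0 mul0r add0r.
    apply: (covered_tame_affine_op reg a0 oG Gb q0 Gq oW) => w /WU/UP[_ _ _ _].
    exact.
  have WG w : W w -> G (1 * w + 0) by move=> /WU/UP[_ _ _ Gw _]; rewrite mul1r addr0.
  apply: covered_weaken (covered_tame_affine_op reg (oner_neq0 K) oG Gb q0 Gq oW WG) _.
  by move=> V _ _; apply: tame_ext => w _; rewrite /affine_op mul1r addr0.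
have cva : covered (fun W => diff_algebraic_on W a) U.
  have := covered_forall oU (fun i W V WV => @tame_sub K W V (c i) WV) cov.
  move=> /covered_weaken; apply=> W oW WU tc; apply: tame_diff_algebraic_on => //.
  have : tame W (mpoly_fun f (eq_args alpha beta b)).
    apply: tame_mpoly_fun => //; first by move=> z /WU/UP[].
    move=> j; rewrite /eq_args; case: fintype.split => [i|l]; first exact: tc.
    apply: tame_derive1n => //; have := tc ord0; rewrite /c.
    by case: unliftP => // i' /eqP; rewrite (negbTE (neq_lift _ _)).
  by apply: tame_ext => w /WU/UP[].
have [|k0 Hk] := covered_diff_algebraic_on cva.
  move=> i z Uz; apply: (derivable_derive1n reg oU) => // w /UP[]//.
have [P [P0 PU]] := Hk k0 (leqnn _).
apply: (diff_algebraic_of_constant P0) => z0.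
by apply: filterS (Unear z0) => w /PU.
Qed.

End MeromorphicFunctions.

Theorem theorem4 (R : realType) (m n : nat) (f : mpoly (m.+1 + n) (ratfun (Cplx R)))
    (a b : Cplx R -> Cplx R) (alpha beta : 'I_m -> Cplx R)
    (a_mero : meromorphic a) (a_dt : diff_transcendental a)
    (b_mero : meromorphic b)
    (E_defined : forall i : 'I_m, alpha i = 0 -> ~ pole b (beta i))
    (b_eq : mero_eq (mpoly_fun f (eq_args alpha beta b)) a) :
  diff_transcendental b.
Proof.
move=> b_da; apply: a_dt.
exact: (diff_algebraic_eq_args (@derivable_derive1 R) a_mero b_mero b_eq b_da).
Qed.
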